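(* Let $n\ge 3$, $R>0$, and let $\mathcal{B}_R$ be a geodesic ball of radius $R$ in the hyperbolic space $\mathbb{H}^n$, i.e. the Riemannian model with metric $ds^2=dr^2+\sinh(r)^2\,d\Theta^2$ in polar coordinates around the center. Consider the problem $$-\Delta_g u=\lambda f(u)\ \text{in }\mathcal{B}_R,\qquad u>0\ \text{in }\mathcal{B}_R,\qquad u=0\ \text{on }\partial\mathcal{B}_R,$$ with extremal parameter $\lambda^*$ and extremal solution $u^*$. Let $N(m):=2+\frac{4m}{m-1}+4\sqrt{\frac{m}{m-1}}$ for $m>1$. (i) If $f(u)=\frac{e^u}{\sinh(R)^2}+\frac{n-1}{n-2}$ and $n\ge 10$, then $\lambda^*=2(n-2)$ and $u^*(r)=-2\log\left(\frac{\sinh r}{\sinh R}\right)$. (ii) If $m>1$, $f(u)=\left(u+\sinh(R)^{-\frac{2}{m-1}}\right)\left(\left(u+\sinh(R)^{-\frac{2}{m-1}}\right)^{m-1}+\frac{(m-1)n-(m+1)}{(m-1)n-2m}\right)$ and $n\ge N(m)$, then $\lambda^*=\frac{2}{m-1}\left(n-\frac{2m}{m-1}\right)$ and $u^*(r)=\sinh(r)^{-\frac{2}{m-1}}-\sinh(R)^{-\frac{2}{m-1}}$.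
   Context: $\Delta_g$ is the Laplace–Beltrami operator and $r$ the geodesic distance to the center of the ball. For $f$ a $C^1$ positive increasing function with $\lim_{t\to\infty}f(t)/t=+\infty$, there is $\lambda^*\in(0,\infty)$ such that for $\lambda\in(0,\lambda^* )$ the problem has a minimal classical solution $u_\lambda$ (smaller than any supersolution), which is semistable and increasing in $\lambda$, and for $\lambda>\lambda^*$ there is no classical solution; $\lambda^*$ is the extremal parameter and $u^*:=\lim_{\lambda\uparrow\lambda^*}u_\lambda$ is the extremal solution, a weak solution for $\lambda=\lambda^*$ (i.e. $u^*\in L^1$, $f(u^* )(R-r)\in L^1$, and $-\int u^*\Delta_g\xi\,dv_g=\lambda^*\int f(u^* )\xi\,dv_g$ for all $\xi\in C^1_0(\mathcal{B}_R)$). *)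

(* Defs.v *)
From HB Require Import structures.
From mathcomp Require Import all_boot all_order all_algebra.
From mathcomp Require Import all_classical all_reals all_analysis.
Set Implicit Arguments. Unset Strict Implicit. Unset Printing Implicit Defensive.
Import Order.TTheory GRing.Theory Num.Theory.
Import numFieldNormedType.Exports.
Local Open Scope classical_set_scope.
Local Open Scope ring_scope.

(* Hyperbolic space H^n realised as the Poincare ball model
   {x in R^n : |x| < 1} with metric (2/(1-|x|^2))^2 |dx|^2; the centre of the
   geodesic ball is the origin.  In geodesic polar coordinates around 0 this
   metric is dr^2 + sinh(r)^2 dTheta^2. *)
Section Hyperbolic.
Variables (R : realType) (n : nat).

Definition sinhR (t : R) : R := (expR t - expR (- t)) / 2.

Definition enorm (x : 'rV[R]_n) : R := Num.sqrt (\sum_i x ord0 i ^+ 2).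

(* hyperbolic geodesic distance from the origin: 2 artanh |x| *)
Definition hdist0 (x : 'rV[R]_n) : R :=
  ln ((1 + enorm x) / (1 - enorm x)).

Definition hball (rho : R) : set 'rV[R]_n :=
  [set x | enorm x < 1 /\ hdist0 x < rho].
Definition hsphere (rho : R) : set 'rV[R]_n :=
  [set x | enorm x < 1 /\ hdist0 x = rho].
Definition hcball (rho : R) : set 'rV[R]_n :=
  [set x | enorm x < 1 /\ hdist0 x <= rho].

Definition ebasis (i : 'I_n) : 'rV[R]_n := delta_mx ord0 i.

Definition pderiv (i : 'I_n) (u : 'rV[R]_n -> R) (x : 'rV[R]_n) : R :=
  'D_(ebasis i) u x.

Definition eLap (u : 'rV[R]_n -> R) (x : 'rV[R]_n) : R :=
  \sum_i pderiv i (pderiv i u) x.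

(* Laplace-Beltrami operator of the Poincare ball metric
   g = e^{2 phi} delta, phi = log(2/(1-|x|^2)):
   Delta_g u = e^{-2phi} (Delta u + (n-2) grad phi . grad u) *)
Definition LapB (u : 'rV[R]_n -> R) (x : 'rV[R]_n) : R :=
  (1 - enorm x ^+ 2) ^+ 2 / 4 * eLap u x
  + (n%:R - 2) * (1 - enorm x ^+ 2) / 2 * \sum_i x ord0 i * pderiv i u x.

Definition C2_on (A : set 'rV[R]_n) (u : 'rV[R]_n -> R) : Prop :=
  forall x, A x ->
    (forall i, derivable u x (ebasis i)) /\
    (forall i j, derivable (pderiv i u) x (ebasis j)) /\
    (forall i j, {for x, continuous (pderiv j (pderiv i u))}).

Definition classical_sol (rho lambda : R) (f : R -> R) (u : 'rV[R]_n -> R)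
  : Prop :=
  [/\ C2_on (hball rho) u,
      {within hcball rho, continuous u},
      (forall x, hball rho x -> - LapB u x = lambda * f (u x)),
      (forall x, hball rho x -> 0 < u x) &
      (forall x, hsphere rho x -> u x = 0)].

Definition classical_supersol (rho lambda : R) (f : R -> R)
  (v : 'rV[R]_n -> R) : Prop :=
  [/\ C2_on (hball rho) v,
      {within hcball rho, continuous v},
      (forall x, hball rho x -> lambda * f (v x) <= - LapB v x),
      (forall x, hball rho x -> 0 <= v x) &
      (forall x, hsphere rho x -> 0 <= v x)].

Definition minimal_sol (rho lambda : R) (f : R -> R) (u : 'rV[R]_n -> R)
  : Prop :=
  classical_sol rho lambda f u /\
  forall v, classical_supersol rho lambda f v ->
    forall x, hball rho x -> u x <= v x.

Definition lambda_star (rho : R) (f : R -> R) : R :=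
  sup [set l : R | 0 < l /\ exists u, classical_sol rho l f u].

Definition f_exp (rho : R) (s : R) : R :=
  expR s / sinhR rho ^+ 2 + (n%:R - 1) / (n%:R - 2).

Definition f_pow (rho m : R) (s : R) : R :=
  let a := powR (sinhR rho) (- (2 / (m - 1))) in
  (s + a) * (powR (s + a) (m - 1)
             + ((m - 1) * n%:R - (m + 1)) / ((m - 1) * n%:R - 2 * m)).

End Hyperbolic.

Definition Ndim {R : realType} (m : R) : R :=
  2 + 4 * m / (m - 1) + 4 * Num.sqrt (m / (m - 1)).

(* Main.v *)
Require Import Defs.
From HB Require Import structures.
From mathcomp Require Import all_boot all_order all_algebra.
From mathcomp Require Import all_classical all_reals all_analysis.
From mathcomp Require Import ring lra.
Import Order.TTheory GRing.Theory Num.Theory.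
Import numFieldNormedType.Exports.
Local Open Scope classical_set_scope.
Local Open Scope ring_scope.
Set Implicit Arguments. Unset Strict Implicit. Unset Printing Implicit Defensive.

(* Write [z = sinh r ^ 2] and let [U] be the singular solution, so that
   [- Delta U = L * f U] away from the origin, with [L] the claimed value of
   lambda^*; everything is deduced from the maximum principle.

   Lower bound. Hardy's inequality enters as the explicit function
   [psi = z ^ (- (n - 2) / 4)], which satisfies
   [- Delta psi >= L * f' U * psi + c * psi] under the dimension condition. For a
   classical solution [u] with parameter [l], the quotient [(U - u) / psi] tends
   to [0] at the origin and vanishes on the boundary;
   evaluating the equation at an interior maximum and using the convexity of [f]
   gives [U - u <= C * max 0 (L - l) * psi]. For [l > L] this forces [U <= u],
   which is absurd since [u] is bounded, hence lambda^* <= L.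

   Upper bound. With [U = W z - W z0], where [z0] is the value of [z] on the
   sphere, the shifted function [W (z + dl) - W (z0 + dl)] is a bounded
   supersolution for every [l < L] once [dl] is small, and lies below [U]. Hence
   the minimal solutions are below [U], and monotone iteration of the radial
   integral operator produces a classical solution for every [l < L]. *)

(** * Radial functions and the Laplace-Beltrami operator *)

(** Hardy's inequality is used through its ground state [psi], not in integral form, so that every
    estimate is the equation read at a single point. With N = n - 2, the leading coefficient of -
    Delta z^-g near the origin is g * (2 * N - 4 * g), in front of z^(-g - 1); it is largest at g =
    N / 4, with value N^2 / 4, Hardy's constant. The dimension conditions ensure that L * z * f'(U)
    is at most this constant at z = 0. The gain c * psi comes from the curvature, that is from the
    terms of the operator of higher order in z; hence it stays strictly positive when the dimension
    condition is an equality. The obstacle is the origin, where [U] and [psi] both blow up: the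
    quotient tends to 0 there because [U] grows more slowly than [psi]. In the variable z the
    operator has polynomial coefficients, so both nonlinearities reduce to W' = - A * z^(-al - 1)
    and are treated together. Shifting z by [dl] removes the singularity at the cost of a factor
    close to 1, which the strict inequality l < L absorbs. *)

Section DeriveFun.
Context {R : realType} {V : normedModType R}.
Implicit Types (f g : V -> R) (x v : V).

Lemma is_derive_addf f g x v a b : is_derive x v f a -> is_derive x v g b ->
  is_derive x v (fun y => f y + g y) (a + b).
Proof. by move=> fa gb; apply: (is_deriveD fa gb). Qed.

Lemma is_derive_oppf f x v a : is_derive x v f a ->
  is_derive x v (fun y => - f y) (- a).
Proof. by move=> fa; apply: (is_deriveN fa). Qed.

Lemma is_derive_subf f g x v a b : is_derive x v f a -> is_derive x v g b ->
  is_derive x v (fun y => f y - g y) (a - b).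
Proof. by move=> fa gb; apply: (is_deriveB fa gb). Qed.

Lemma is_derive_mulf f g x v a b : is_derive x v f a -> is_derive x v g b ->
  is_derive x v (fun y => f y * g y) (f x * b + g x * a).
Proof. by move=> fa gb; apply: (is_deriveM fa gb). Qed.

Lemma is_derive_scalef (k : R) f x v a : is_derive x v f a ->
  is_derive x v (fun y => k * f y) (k * a).
Proof. by move=> fa; apply: (is_deriveZ k fa). Qed.

Lemma is_derive_expf n f x v a : is_derive x v f a ->
  is_derive x v (fun y => f y ^+ n) (n%:R * f x ^+ n.-1 * a).
Proof. by move=> fa; have := is_deriveX n fa; rewrite exprfctE. Qed.

(** Moves partial derivatives to the real line, where the chain rule and the mean value theorem for
    one variable apply. *)
Lemma is_derive_lineP f x v a :
  is_derive x v f a <-> is_derive (0 : R) 1 (fun h : R => f (h *: v + x)) a.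
Proof.
have E : 'D_v f x = 'D_1 (fun h : R => f (h *: v + x)) 0.
  rewrite /derive; set F := (X in X @ _); set F' := (X in _ = lim (X @ _)).
  have -> // : F = F'; apply/funext => h; rewrite /F /F' /= /shift /=.
  by rewrite scale0r add0r addr0 [h *: 1]mulr1.
split=> -[df <-]; apply: DeriveDef; rewrite -?E //.
  by have [+ _] := derivable1P f x v; apply.
by have [_] := derivable1P f x v; apply.
Qed.

End DeriveFun.

Lemma is_derive_compf {R : realType} (f g : R -> R) (x a b : R) :
  is_derive (g x) 1 f a -> is_derive x 1 g b ->
  is_derive x 1 (fun y => f (g y)) (a * b).
Proof. by move=> fa gb; apply: (@is_derive1_comp R f g x a b). Qed.

Lemma is_derive_onem_inv_exp {R : realType} (t : R) k : 1 - t != 0 ->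
  is_derive t 1 (fun t : R => (1 - t)^-1 ^+ k) (k%:R * (1 - t)^-1 ^+ k.+1).
Proof.
move=> t1.
have d1 : is_derive t 1 (fun t : R => 1 - t) (0 - 1).
  exact: (is_derive_subf (is_derive_cst _ _ _) (is_derive_id _ _)).
have d2 := is_derive_expf k (@is_deriveV R (fun t => 1 - t) t _ 1 t1 d1).
apply: (is_derive_eq d2).
case: k {d2} => [|k /=]; first by rewrite !mul0r.
by rewrite /GRing.scale /= -exprVn sub0r mulrN1 opprK !exprS; ring.
Qed.

Lemma is_derive_cont {R : realType} (f : R -> R) (x a : R) :
  is_derive x 1 f a -> {for x, continuous f}.
Proof.
move=> [df _]; apply: differentiable_continuous; exact/derivable1_diffP.
Qed.

Section ContFun.
Context {R : realType} {T : topologicalType}.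
Implicit Types (f g : T -> R) (x : T).

Lemma cont_mulf f g x : {for x, continuous f} -> {for x, continuous g} ->
  {for x, continuous (fun y => f y * g y)}.
Proof. by move=> cf cg; apply: cvgM. Qed.

Lemma cont_addf f g x : {for x, continuous f} -> {for x, continuous g} ->
  {for x, continuous (fun y => f y + g y)}.
Proof. by move=> cf cg; apply: cvgD. Qed.

Lemma cont_oppf f x : {for x, continuous f} ->
  {for x, continuous (fun y => - f y)}.
Proof. by move=> cf; apply: cvgN. Qed.

Lemma cont_cst (c : R) x : {for x, continuous (fun=> c)}.
Proof. exact: cvg_cst. Qed.

Lemma cont_expf k f x : {for x, continuous f} ->
  {for x, continuous (fun y => f y ^+ k)}.
Proof.
move=> cf; apply: (@continuous_comp _ _ _ f (fun t : R => t ^+ k)) => //.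
exact: exprn_continuous.
Qed.

Lemma cont_compf (h : R -> R) f x : {for x, continuous f} ->
  {for f x, continuous h} -> {for x, continuous (fun y => h (f y))}.
Proof. by move=> cf ch; apply: (@continuous_comp _ _ _ f h). Qed.

End ContFun.

Lemma cont_id {R : realType} (x : R) : {for x, continuous (fun y : R => y)}.
Proof. exact: cvg_id. Qed.

Arguments cont_cst {R T} c x.
Arguments cont_expf {R T} k [f x].
Arguments cont_id {R} x.

Lemma near_itv_oo {R : realType} (a b t : R) : a < t < b ->
  \forall s \near t, a < s < b.
Proof.
move=> /andP[at_ tb]; near=> s; apply/andP; split; near: s.
  exact: lt_nbhsr.
exact: lt_nbhsl.
Unshelve. all: end_near. Qed.

Lemma is_derive_MVT {R : realType} (f df : R -> R) (a b : R) : a < b ->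
  (forall s, a <= s <= b -> is_derive s 1 f (df s)) ->
  exists2 c, a < c < b & f b - f a = df c * (b - a).
Proof.
move=> ab fd.
have [||c] := @MVT R f df a b ab.
- by move=> s; rewrite in_itv /= => /andP[? ?]; apply: fd; rewrite !ltW.
- apply: derivable_within_continuous => s; rewrite in_itv /= => sab.
  by have [] := fd s sab.
- by rewrite in_itv /= => cab E; exists c.
Qed.

Section LineMax.
Context {R : realType}.

Lemma is_derive_pos_right (f : R -> R) (d : R) : f 0 = 0 -> 0 < d ->
  is_derive (0 : R) 1 f d ->
  exists2 e : R, 0 < e & forall s, 0 < s < e -> 0 < f s.
Proof.
move=> f0 d0 [fd fdE].
have : h^-1 *: (f (h *: (1 : R) + 0) - f 0) @[h --> (0 : R)^'] --> d.
  by rewrite -fdE; exact: fd.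
move/cvgrPdist_lt => /(_ d d0) [e /= e0 He].
exists e => // s /andP[s0 se].
have /= := He s; rewrite /ball_ /= sub0r normrN gtr0_norm // => /(_ se).
rewrite gt_eqF // => /(_ isT); rewrite f0 subr0 addr0 [s *: 1]mulr1 => H.
have : 0 < s^-1 * f s by move: H; rewrite ltr_distlC /GRing.scale /= subrr => /andP[].
by rewrite pmulr_rgt0 // invr_gt0.
Qed.

(** If [d] were positive, [h'] would be positive just to the right of 0, and the mean value theorem
    would lift [h] above [h 0]. *)
Lemma second_derive_local_max (h h' : R -> R) (d : R) (e : R) : 0 < e ->
  (forall s : R, `|s| < e -> is_derive s 1 h (h' s)) ->
  is_derive (0 : R) 1 h' d -> (forall s, `|s| < e -> h s <= h 0) ->
  h' 0 = 0 /\ d <= 0.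
Proof.
move=> e0 hd h'd hm.
have inE' s : s \in `](- e), e[ -> `|s| < e by rewrite in_itv /= ltr_norml.
have h'0 : h' 0 = 0.
  have [_ <-] : is_derive (0 : R) 1 h (h' 0) by apply: hd; rewrite normr0.
  have [||||_ //] // := @derive1_at_max R h (- e) e 0.
  - by rewrite ge0_cp // ltW.
  - by move=> t /inE' /hd[].
  - by rewrite in_itv /= oppr_lt0 e0.
  - by move=> t /inE'; exact: hm.
split=> //; rewrite leNgt; apply/negP => d0.
have [e' e'0 He'] := is_derive_pos_right h'0 d0 h'd.
pose m := Num.min e e' / 2.
have m0 : 0 < m by rewrite divr_gt0 // lt_min e0.
have mm : m < Num.min e e'.
  by rewrite ltr_pdivrMr // mulr2n mulrDr mulr1 ltrDl lt_min e0.
have [me me'] : m < e /\ m < e' by move: mm; rewrite lt_min => /andP[].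
have [|c /andP[c0 cm] E] := @is_derive_MVT R h h' 0 m m0.
  move=> s /andP[s0 sm]; apply: hd; rewrite ger0_norm //; exact: le_lt_trans me.
have : h m <= h 0 by apply: hm; rewrite gtr0_norm.
have : 0 < h' c by apply: He'; rewrite c0 (lt_trans cm).
move=> h'c; rewrite -subr_le0 E subr0 leNgt.
by rewrite mulr_gt0.
Qed.

End LineMax.

Section Radial.
Context {R : realType} {n : nat}.
Implicit Types (x y : 'rV[R]_n) (i j : 'I_n).

(** Radial functions are written in this variable instead of the norm: it is polynomial in the
    coordinates, so the origin is no exceptional point for smoothness. *)
Definition sqn x : R := \sum_i x ord0 i ^+ 2.

Lemma sqn_ge0 x : 0 <= sqn x.
Proof. by apply: sumr_ge0 => i _; exact: sqr_ge0. Qed.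

Lemma sqn0 : sqn 0 = 0.
Proof. by rewrite /sqn big1 // => i _; rewrite mxE expr0n. Qed.

Lemma sqn_gt0 x : (0 < sqn x) = (x != 0).
Proof.
apply/idP/idP => [|x0]; first by apply: contraTneq => ->; rewrite sqn0 ltxx.
rewrite lt_neqAle sqn_ge0 andbT eq_sym; apply: contraNneq x0 => /eqP.
rewrite psumr_eq0; last by move=> i _; exact: sqr_ge0.
move=> /allP H; apply/eqP/rowP => i; rewrite mxE.
by apply/eqP; rewrite -sqrf_eq0; apply: H; rewrite mem_index_enum.
Qed.

Lemma enorm_sqr x : enorm x ^+ 2 = sqn x.
Proof. by rewrite /enorm sqr_sqrtr // sqn_ge0. Qed.

Lemma coord_cont i : continuous (fun x => x ord0 i : R).
Proof. exact: coord_continuous. Qed.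

Lemma sqn_cont : continuous sqn.
Proof.
apply: continuous_big => [|i _ x]; first exact: add_continuous.
apply: (@continuous_comp _ _ _ (fun y => y ord0 i) (fun t : R => t ^+ 2)).
  exact: coord_cont.
exact: exprn_continuous.
Qed.

Lemma line_coord x i j (h : R) :
  (h *: ebasis R i + x) ord0 j = h * (i == j)%:R + x ord0 j.
Proof. by rewrite !mxE eqxx /= eq_sym. Qed.

Lemma sqn_line x i (h : R) :
  sqn (h *: ebasis R i + x) = h ^+ 2 + 2 * x ord0 i * h + sqn x.
Proof.
rewrite /sqn (bigD1 i) //= [in RHS](bigD1 i) //= line_coord eqxx mulr1.
rewrite (eq_bigr (fun j => x ord0 j ^+ 2)); last first.
  by move=> j ji; rewrite line_coord eq_sym (negbTE ji) mulr0 add0r.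
ring.
Qed.

Lemma is_derive_sqn x i : is_derive x (ebasis R i) sqn (2 * x ord0 i).
Proof.
apply/is_derive_lineP.
rewrite (_ : (fun h => _) = (fun h : R => h ^+ 2 + 2 * x ord0 i * h + sqn x));
  last by apply/funext => h; rewrite sqn_line.
apply: (@is_derive_eq _ _ _ _ _ _ _ ((2%:R * (0 : R) ^+ 2.-1 * 1 + 2 * x ord0 i * 1) + 0));
  last by ring.
exact: (is_derive_addf (is_derive_addf (is_derive_expf 2 (is_derive_id _ _))
  (is_derive_scalef _ (is_derive_id _ _))) (is_derive_cst _ _ _)).
Qed.

Lemma is_derive_coord x i j :
  is_derive x (ebasis R i) (fun y => y ord0 j : R) (i == j)%:R.
Proof.
apply/is_derive_lineP.
under eq_fun do rewrite line_coord.
apply: (@is_derive_eq _ _ _ _ _ _ _ (0 * 0 + (i == j)%:R * 1 + 0 : R));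
  last by ring.
exact: (is_derive_addf (is_derive_mulf (is_derive_id _ _) (is_derive_cst _ _ _))
  (is_derive_cst _ _ _)).
Qed.

Lemma is_derive_radial (G : R -> R) g x i : is_derive (sqn x) 1 G g ->
  is_derive x (ebasis R i) (fun y => G (sqn y)) (g * (2 * x ord0 i)).
Proof.
move=> Gg; apply/is_derive_lineP.
apply: (@is_derive_compf _ G (fun h : R => sqn (h *: ebasis R i + x))).
  by rewrite scale0r add0r.
by have /is_derive_lineP := is_derive_sqn x i.
Qed.

Variables (a b : R) (G G1 G2 : R -> R).
Hypothesis G_d : forall t : R, a < t < b -> is_derive t 1 G (G1 t).
Hypothesis G1_d : forall t : R, a < t < b -> is_derive t 1 G1 (G2 t).
Let u x := G (sqn x).

Lemma pderiv_radial x i : a < sqn x < b ->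
  is_derive x (ebasis R i) u (2 * x ord0 i * G1 (sqn x)).
Proof. by move=> xab; rewrite mulrC; apply/is_derive_radial/G_d. Qed.

Lemma pderiv_radialE x i : a < sqn x < b ->
  pderiv i u x = 2 * x ord0 i * G1 (sqn x).
Proof. by move=> /(pderiv_radial i)[_]. Qed.

Lemma near_sqn_oo x : a < sqn x < b -> \forall y \near x, a < sqn y < b.
Proof. by move=> /near_itv_oo; apply: (@sqn_cont x). Qed.

Lemma pderiv2_radial x i j : a < sqn x < b ->
  is_derive x (ebasis R j) (pderiv i u)
    (2 * (i == j)%:R * G1 (sqn x) + 4 * x ord0 i * x ord0 j * G2 (sqn x)).
Proof.
move=> xab.
apply: (@near_eq_is_derive _ _ _ (fun y => 2 * y ord0 i * G1 (sqn y))).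
  by apply: filterS (near_sqn_oo xab) => y /pderiv_radialE ->.
have -> : 2 * (i == j)%:R * G1 (sqn x) + 4 * x ord0 i * x ord0 j * G2 (sqn x)
  = 2 * x ord0 i * (G2 (sqn x) * (2 * x ord0 j)) + G1 (sqn x) * (2 * (j == i)%:R).
  by rewrite eq_sym; ring.
exact: (is_derive_mulf (is_derive_scalef 2 (is_derive_coord x j i))
  (is_derive_radial j (G1_d xab))).
Qed.

Lemma pderiv2_radialE x i j : a < sqn x < b ->
  pderiv j (pderiv i u) x =
    2 * (i == j)%:R * G1 (sqn x) + 4 * x ord0 i * x ord0 j * G2 (sqn x).
Proof. by move=> /(pderiv2_radial i j)[_]. Qed.

Lemma C2_radial (A : set 'rV[R]_n) :
  (forall t, a < t < b -> {for t, continuous G2}) ->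
  (forall x, A x -> a < sqn x < b) -> C2_on A u.
Proof.
move=> G2c Aab x /Aab xab; split=> [i|]; first by have [] := pderiv_radial i xab.
split=> i j; first by have [] := pderiv2_radial i j xab.
rewrite /prop_for /continuous_at pderiv2_radialE //.
pose F y : R := 2 * (i == j)%:R * G1 (sqn y)
    + 4 * y ord0 i * y ord0 j * G2 (sqn y).
suff Fc : {for x, continuous F}.
  apply: cvg_trans Fc; apply: (@near_eq_cvg _ _ (nbhs x)); near=> y.
  by rewrite pderiv2_radialE //; near: y; exact: near_sqn_oo.
have cs (H : R -> R) : {for sqn x, continuous H} ->
    H (sqn y) @[y --> x] --> H (sqn x).
  by move=> cH; apply: (@continuous_comp _ _ _ sqn H x) => //; exact: sqn_cont.
have c1 := cs _ (is_derive_cont (G1_d xab)).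
have c2 := cs _ (G2c _ xab).
exact: (cvgD (cvgM (cvg_cst _) c1) (cvgM (cvgM (cvgM (cvg_cst _)
  (@coord_cont i x)) (@coord_cont j x)) c2)).
Unshelve. all: end_near. Qed.

Lemma LapB_radial x : a < sqn x < b ->
  LapB u x = (1 - sqn x) ^+ 2 * (sqn x * G2 (sqn x) + n%:R / 2 * G1 (sqn x))
    + (n%:R - 2) * (1 - sqn x) * sqn x * G1 (sqn x).
Proof.
move=> xab; rewrite /LapB /eLap enorm_sqr.
rewrite (eq_bigr (fun i => 2 * G1 (sqn x) + 4 * G2 (sqn x) * x ord0 i ^+ 2));
  last by move=> i _; rewrite pderiv2_radialE // eqxx mulr1; ring.
rewrite [X in _ + _ * X](eq_bigr (fun i => 2 * G1 (sqn x) * x ord0 i ^+ 2));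
  last by move=> i _; rewrite pderiv_radialE //; ring.
rewrite big_split /= -!mulr_sumr sumr_const card_ord -/(sqn x) -mulr_natr.
by field.
Qed.

End Radial.

Section LapMax.
Context {R : realType} {n : nat}.
Implicit Types (u v : 'rV[R]_n -> R) (x : 'rV[R]_n).

Lemma near_line (A : set 'rV[R]_n) x i : (\forall y \near x, A y) ->
  exists2 e : R, 0 < e & forall s, `|s| < e -> A (s *: ebasis R i + x).
Proof.
move=> Ax.
have : (fun s : R => s *: ebasis R i + x) @ (0 : R) --> x.
  rewrite -[X in _ --> X]add0r -(scale0r (ebasis R i)).
  by apply: cvgD; [exact: scalel_continuous|exact: cvg_cst].
move=> /(_ _ Ax) [e /= e0 He]; exists e => // s se.
by apply: He; rewrite /ball_ /= sub0r normrN.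
Qed.

(** Along every coordinate line [u - v] has a local maximum at [x], so the first partials agree and
    the pure second partials are ordered. [LapB] involves no mixed partials, and its second-order
    factor is nonnegative. *)
Lemma LapB_local_max (A : set 'rV[R]_n) u v x : enorm x < 1 ->
  C2_on A u -> C2_on A v -> (\forall y \near x, A y) ->
  (\forall y \near x, u y - v y <= u x - v x) ->
  LapB u x <= LapB v x.
Proof.
move=> x1 uC vC nA nmax.
have Ax := nbhs_singleton nA.
have key i : pderiv i u x = pderiv i v x /\
    pderiv i (pderiv i u) x <= pderiv i (pderiv i v) x.
  have [e e0 He] : exists2 e : R, 0 < e & forall s, `|s| < e ->
      A (s *: ebasis R i + x) /\
      u (s *: ebasis R i + x) - v (s *: ebasis R i + x) <= u x - v x.
    apply: (@near_line (fun y => A y /\ u y - v y <= u x - v x)).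
    by apply: filterS2 nA nmax.
  pose l (s : R) := s *: ebasis R i + x.
  have l0 : l 0 = x by rewrite /l scale0r add0r.
  have ld (w : 'rV[R]_n -> R) s : derivable w (l s) (ebasis R i) ->
      is_derive s 1 (w \o l) (pderiv i w (l s)).
    move=> dw; have [dl dlE] : is_derive (l s) (ebasis R i) w (pderiv i w (l s)).
      exact: DeriveDef.
    have /is_derive_lineP H : is_derive (l s) (ebasis R i) w (pderiv i w (l s)).
      exact: DeriveDef.
    have H' : is_derive (s - s) 1 (fun h : R => w (h *: ebasis R i + l s))
        (pderiv i w (l s)) by rewrite subrr.
    have -> : w \o l = (fun y : R => w ((y - s) *: ebasis R i + l s)).
      apply/funext => y /=; congr w.
      by rewrite /l addrA -scalerDl subrK.
    rewrite -[pderiv i w (l s)]mulr1.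
    apply: (@is_derive_compf _ (fun h : R => w (h *: ebasis R i + l s))
       (fun y => y - s)) => //.
    rewrite -[X in is_derive _ _ _ X]subr0.
    exact: is_derive_subf.
  have [||s se|H1 H2] := @second_derive_local_max R
    (fun s => u (l s) - v (l s))
    (fun s => pderiv i u (l s) - pderiv i v (l s))
    (pderiv i (pderiv i u) x - pderiv i (pderiv i v) x) e e0.
  - move=> s se; have [As _] := He s se.
    by apply: is_derive_subf; apply: ld; [have [] := uC _ As|have [] := vC _ As].
  - have := uC _ Ax; have := vC _ Ax; rewrite -{1 2 5 6}l0.
    move=> [_ [dv _]] [_ [du _]].
    by rewrite -{1 2}l0; apply: is_derive_subf; apply: ld.
  - by rewrite l0; have [] := He s se.
  - move: H1 H2; rewrite l0 => /eqP; rewrite subr_eq0 => /eqP ->.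
    by rewrite subr_le0.
rewrite /LapB /eLap.
rewrite [X in _ + _ * X <= _](eq_bigr (fun i => x ord0 i * pderiv i v x)); last first.
  by move=> i _; have [-> _] := key i.
rewrite lerD2r ler_wpM2l //.
  by rewrite divr_ge0 // sqr_ge0.
by apply: ler_sum => i _; have [] := key i.
Qed.

End LapMax.

(** * Hyperbolic balls in the variable |x|^2 *)

Section Geometry.
Context {R : realType} {n : nat}.
Implicit Types (x : 'rV[R]_n) (rho t : R).

(** This is sinh(r)^2 as a function of t = |x|^2, because r = 2 artanh |x| and sinh(2 artanh y) = 2
    * y / (1 - y^2). *)
Definition sh2 t : R := 4 * t / (1 - t) ^+ 2.

(** tanh(rho / 2)^2, the squared Euclidean radius of the hyperbolic ball of radius [rho]. *)
Definition tmax rho : R := ((expR rho - 1) / (expR rho + 1)) ^+ 2.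

Let y0 rho : R := (expR rho - 1) / (expR rho + 1).

Lemma sinhR_ln (y : R) : 0 <= y < 1 ->
  sinhR (ln ((1 + y) / (1 - y))) = 2 * y / (1 - y ^+ 2).
Proof.
move=> /andP[y_ge0 y1]; rewrite /sinhR expRN lnK ?posrE; last first.
  by rewrite divr_gt0 ?subr_gt0 // ltr_wpDr.
have a0 : 1 - y != 0 by rewrite subr_eq0 gt_eqF.
have b0 : 1 + y != 0 by rewrite gt_eqF // ltr_wpDr.
have -> : 1 - y ^+ 2 = (1 - y) * (1 + y) by ring.
by field; rewrite a0 b0.
Qed.

Lemma expR_ratio rho : 0 < rho ->
  [/\ 0 < y0 rho, y0 rho < 1 & rho = ln ((1 + y0 rho) / (1 - y0 rho))].
Proof.
move=> r0; have e1 : 1 < expR rho by rewrite expR_gt1.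
have e0 : 0 < expR rho + 1 by lra.
split; first by rewrite divr_gt0 // subr_gt0.
  by rewrite ltr_pdivrMr // mul1r ltrD2l; lra.
rewrite -[LHS]expRK /y0; congr ln; field.
by rewrite gt_eqF //=; lra.
Qed.

Lemma tmax_bounds rho : 0 < rho -> 0 < tmax rho < 1.
Proof.
move=> /expR_ratio[y_gt0 y1 _]; rewrite /tmax -/(y0 rho) exprn_gt0 //=.
by rewrite expr_lt1 // ltW.
Qed.

Lemma sh2_tmax rho : 0 < rho -> sh2 (tmax rho) = sinhR rho ^+ 2.
Proof.
move=> r0; have [y_gt0 y1 {2}->] := expR_ratio r0.
rewrite sinhR_ln ?y1 ?ltW // /sh2 /tmax -/(y0 rho).
by field; rewrite gt_eqF // subr_gt0 expr_lt1 // ltW.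
Qed.

Lemma sinhR_gt0 rho : 0 < rho -> 0 < sinhR rho.
Proof.
move=> r0; rewrite /sinhR divr_gt0 // subr_gt0 ltr_expR.
by rewrite (lt_trans _ r0) // oppr_lt0.
Qed.

Lemma sinhR_hdist0_sqr x : enorm x < 1 -> sinhR (hdist0 x) ^+ 2 = sh2 (sqn x).
Proof.
move=> x1; rewrite /hdist0 sinhR_ln ?x1 ?sqrtr_ge0 // /sh2 -enorm_sqr.
by field; rewrite gt_eqF // subr_gt0 expr_lt1 // sqrtr_ge0.
Qed.

Lemma hdist0_gt0 x : enorm x < 1 -> x != 0 -> 0 < hdist0 x.
Proof.
move=> x1 x0; have e0 : 0 < enorm x by rewrite /enorm sqrtr_gt0 sqn_gt0.
rewrite /hdist0 ln_gt0 // ltr_pdivlMr ?subr_gt0 // mul1r.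
by rewrite ltrD2l; lra.
Qed.

Lemma enorm_ge0 x : 0 <= enorm x. Proof. exact: sqrtr_ge0. Qed.

Lemma hdist0_cmp rho x : 0 < rho -> enorm x < 1 ->
  ((hdist0 x < rho) = (sqn x < tmax rho)) *
  ((hdist0 x == rho) = (sqn x == tmax rho)).
Proof.
move=> r0 x1; have [y_gt0 y1 rE] := expR_ratio r0.
have e0 := enorm_ge0 x.
rewrite -enorm_sqr /tmax -/(y0 rho) /hdist0.
move: (enorm x) (y0 rho) x1 e0 y_gt0 y1 rE => z y x1 e0 y_gt0 y1 ->.
have p1 : 0 < (1 + z) / (1 - z) by rewrite divr_gt0; lra.
have p2 : 0 < (1 + y) / (1 - y) by rewrite divr_gt0; lra.
have -> : (z ^+ 2 == y ^+ 2) = (z == y) by rewrite eqrXn2 // ltW.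
split.
  rewrite ltr_ln ?posrE // ltr_pdivrMr ?subr_gt0 // mulrAC.
  rewrite ltr_pdivlMr ?subr_gt0 // ltr_pXn2r ?nnegrE // 1?ltW //.
  by apply/idP/idP => H; nra.
apply/idP/idP => [/eqP|/eqP -> //].
move=> /(congr1 expR); rewrite !lnK ?posrE // => /eqP.
rewrite eqr_div; [|by rewrite gt_eqF; lra|by rewrite gt_eqF; lra].
by move=> /eqP H; apply/eqP; nra.
Qed.

Lemma tmax_enorm rho x : 0 < rho -> sqn x <= tmax rho -> enorm x < 1.
Proof.
move=> r0; have [y_gt0 y1 _] := expR_ratio r0.
rewrite -enorm_sqr /tmax -/(y0 rho) ler_pXn2r // ?nnegrE ?enorm_ge0 ?(ltW y_gt0) //.
by move=> /le_lt_trans; apply.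
Qed.

Lemma hballE rho x : 0 < rho -> hball rho x <-> sqn x < tmax rho.
Proof.
move=> r0; split => [[x1]|H]; first by rewrite (hdist0_cmp r0 x1).
have x1 := tmax_enorm r0 (ltW H); by split => //; rewrite (hdist0_cmp r0 x1).
Qed.

Lemma hsphereE rho x : 0 < rho -> hsphere rho x <-> sqn x = tmax rho.
Proof.
move=> r0; split => [[x1 /eqP]|H].
  by rewrite (hdist0_cmp r0 x1) => /eqP.
have x1 : enorm x < 1 by apply: (tmax_enorm r0); rewrite H.
by split => //; apply/eqP; rewrite (hdist0_cmp r0 x1) H.
Qed.

Lemma hcballE rho x : 0 < rho -> hcball rho x <-> sqn x <= tmax rho.
Proof.
move=> r0; split => [[x1]|H].
  by rewrite !le_eqVlt !(hdist0_cmp r0 x1).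
have x1 := tmax_enorm r0 H; split => //.
by move: H; rewrite !le_eqVlt !(hdist0_cmp r0 x1).
Qed.

End Geometry.

(** * Radial solutions below a supersolution *)

Section Averages.
Context {R : realType}.
Notation mu := (@lebesgue_measure R).
Implicit Types (H : R -> R) (p q t : R).

(** For t > 0 the substitution r = t * s^2 turns this into t^(-(k + 1) / 2) times the integral over
    [0, t] of r^((k - 1) / 2) * H r, the usual solution formula of a radial equation. The rescaled
    form involves no fractional power and makes sense across t = 0. *)
Definition Av (k : nat) H t : R :=
  \int[mu]_(s in `[0, 1]) (2 * s ^+ k * H (t * s ^+ 2)).

Lemma cont_at_integrable (f : R -> R) (a b : R) :
  (forall s, a <= s <= b -> {for s, continuous f}) ->
  mu.-integrable `[a, b] (EFin \o f).
Proof.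
move=> fc; apply: continuous_compact_integrable; first exact: segment_compact.
apply: continuous_in_subspaceT => s; rewrite inE /= in_itv /=; exact: fc.
Qed.

Lemma cont_at_bounded (f : R -> R) (a b : R) : a <= b ->
  (forall s, a <= s <= b -> {for s, continuous f}) ->
  exists2 B, 0 <= B & forall s, a <= s <= b -> `|f s| <= B.
Proof.
move=> ab fc.
have [|c cab cm] := @EVT_max R (fun s => `|f s|) a b ab.
  apply: continuous_in_subspaceT => s; rewrite inE /= in_itv /= => sab.
  by apply: (@continuous_comp _ _ _ f Num.norm); [exact: fc|exact: norm_continuous].
by exists `|f c| => // s sab; apply: cm; rewrite in_itv.
Qed.

Lemma scale_sqr_between p q t (s : R) : p <= 0 <= q -> p <= t <= q ->
  0 <= s <= 1 -> p <= t * s ^+ 2 <= q.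
Proof.
move=> /andP[p0 q0] /andP[pt tq] /andP[s0 s1].
have s2 : 0 <= s ^+ 2 <= 1 by rewrite sqr_ge0 /= expr_le1.
by nra.
Qed.

Lemma scale_sqr_between_lt p q t (s : R) : p < 0 < q -> p < t < q ->
  0 <= s <= 1 -> p < t * s ^+ 2 < q.
Proof.
move=> /andP[p0 q0] /andP[pt tq] /andP[s0 s1].
have /andP[a0 a1] : 0 <= s ^+ 2 <= 1 by rewrite sqr_ge0 /= expr_le1.
have [t0|t0] := leP 0 t; apply/andP; split.
- by rewrite (lt_le_trans p0) // mulr_ge0.
- by rewrite (le_lt_trans _ tq) // ler_piMr.
- by rewrite (lt_le_trans pt) // ler_niMr // ltW.
- by rewrite (le_lt_trans _ q0) // mulr_le0_ge0 // ltW.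
Qed.

Variables (p q : R) (p0q : p < 0 < q).

Let cont_on H := forall t : R, p < t < q -> {for t, continuous H}.

Lemma Av_integrand_cont k H t (s : R) : cont_on H -> p < t < q -> 0 <= s <= 1 ->
  {for s, continuous (fun s : R => 2 * s ^+ k * H (t * s ^+ 2))}.
Proof.
move=> Hc tpq s01.
have c1 : {for s, continuous (fun s : R => t * s ^+ 2)}.
  exact: (cont_mulf (cont_cst _ _) (cont_expf 2 (cont_id s))).
have c2 : {for s, continuous (fun s : R => 2 * s ^+ k)}.
  exact: (cont_mulf (cont_cst _ _) (cont_expf k (cont_id s))).
apply: (cont_mulf c2); apply: (cont_compf c1).
by apply: Hc; apply: scale_sqr_between_lt.
Qed.

Lemma Av_integrable k H t : cont_on H -> p < t < q ->
  mu.-integrable `[0, 1] (EFin \o (fun s : R => 2 * s ^+ k * H (t * s ^+ 2))).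
Proof.
by move=> Hc tpq; apply: cont_at_integrable => s s01; exact: Av_integrand_cont.
Qed.

Lemma Av_le k H1 H2 t : cont_on H1 -> cont_on H2 -> p < t < q ->
  (forall s, 0 <= s <= 1 -> H1 (t * s ^+ 2) <= H2 (t * s ^+ 2)) ->
  Av k H1 t <= Av k H2 t.
Proof.
move=> c1 c2 tpq H12; apply: le_Rintegral => //; try exact: Av_integrable.
move=> s /=; rewrite in_itv /= => s01; apply: ler_wpM2l; last exact: H12.
by rewrite mulr_ge0 // exprn_ge0 //; case/andP: s01.
Qed.

Lemma Av_norm_bound k (c s B : R) : 0 <= s <= 1 -> `|c| <= B ->
  `|2 * s ^+ k * c| <= 2 * B.
Proof.
move=> /andP[s0 s1] cB; rewrite normrM [X in X * _]ger0_norm; last first.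
  by rewrite mulr_ge0 // exprn_ge0.
apply: ler_pM => //; first by rewrite mulr_ge0 // exprn_ge0.
by rewrite ler_piMr // exprn_ile1.
Qed.

(** The average at [t] sees the whole segment from 0 to [t]. Dominated convergence therefore wants a
    compact subinterval of ]p, q[ that surrounds both points, on which the integrand is bounded. *)
Lemma Av_nested t : p < t < q ->
  exists u v : R, [/\ p < u, u < 0, 0 < v, v < q & u < t < v].
Proof.
move=> /andP[pt tq]; case/andP: p0q => p0 q0.
exists ((p + Num.min t 0) / 2), ((q + Num.max t 0) / 2).
have m1 : p < Num.min t 0 by rewrite lt_min pt p0.
have m2 : Num.max t 0 < q by rewrite gt_max tq q0.
have [a1 a2] : Num.min t 0 <= t /\ Num.min t 0 <= 0 by rewrite !ge_min !lexx orbT.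
have [b1 b2] : t <= Num.max t 0 /\ 0 <= Num.max t 0 by rewrite !le_max !lexx orbT.
by split; lra.
Qed.

Lemma Av_cont k H : cont_on H -> cont_on (Av k H).
Proof.
move=> Hc t tpq; have [u [v [pu u0 v0 vq tuv]]] := Av_nested tpq.
have [||B B0 HB] := @cont_at_bounded H u v.
- by rewrite ltW // (lt_trans u0).
- by move=> s sab; apply: Hc; lra.
have sub x : u < x < v -> p < x < q by lra.
have uv (s x : R) : u < x < v -> 0 <= s <= 1 -> u <= x * s ^+ 2 <= v.
  by move=> xuv; apply: scale_sqr_between; lra.
apply: (@continuity_under_integral R _ _ mu
  (fun t s => 2 * s ^+ k * H (t * s ^+ 2)) `[0, 1] _ u v _ _ (cst (2 * B))) => //.
- by move=> x; rewrite /= in_itv /= => xuv; apply: Av_integrable => //; exact: sub.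
- apply: aeW => s; rewrite /= in_itv /= => s01 x; rewrite inE /= in_itv /= => xuv.
  apply: (cont_mulf (cont_cst _ _)).
  apply: (cont_compf (cont_mulf (cont_id x) (cont_cst _ _))).
  by apply: Hc; have := uv s x xuv s01; lra.
- by apply: cont_at_integrable => s _; exact: cst_continuous.
- move=> x; rewrite /= in_itv /= => xuv; apply: aeW => s; rewrite /= in_itv /= => s01.
  by apply: Av_norm_bound => //; apply: HB; exact: uv.
- by rewrite inE /= in_itv.
Qed.

Lemma Av_derive k H H' : (forall t : R, p < t < q -> is_derive t 1 H (H' t)) ->
  cont_on H' -> forall t : R, p < t < q -> is_derive t 1 (Av k H) (Av k.+2 H' t).
Proof.
move=> Hd Hc' t tpq; have [u [v [pu u0 v0 vq tuv]]] := Av_nested tpq.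
have Hc : cont_on H by move=> s /Hd; exact: is_derive_cont.
have [||B B0 HB] := @cont_at_bounded H' u v.
- by rewrite ltW // (lt_trans u0).
- by move=> s sab; apply: Hc'; lra.
have sub x : u < x < v -> p < x < q by lra.
have uv (s x : R) : u < x < v -> 0 <= s <= 1 -> u <= x * s ^+ 2 <= v.
  by move=> xuv; apply: scale_sqr_between; lra.
pose f t (s : R) := 2 * s ^+ k * H (t * s ^+ 2).
have fd (x s : R) : u < x < v -> 0 <= s <= 1 ->
    is_derive x 1 (f ^~ s) (2 * s ^+ k.+2 * H' (x * s ^+ 2)).
  move=> xuv s01; have xs := uv s x xuv s01.
  have d1 : is_derive x 1 (fun y : R => y * s ^+ 2) (s ^+ 2).
    have := is_derive_mulf (is_derive_id x 1) (is_derive_cst (s ^+ 2) x 1).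
    by rewrite mulr0 add0r mulr1.
  have d2 : is_derive (x * s ^+ 2) 1 H (H' (x * s ^+ 2)) by apply: Hd; lra.
  have d3 := is_derive_scalef (2 * s ^+ k) 
    (@is_derive_compf R H (fun y : R => y * s ^+ 2) x _ _ d2 d1).
  by apply: (is_derive_eq d3); rewrite !exprS; ring.
have tI : [set` `]u, v[] t by rewrite /= in_itv.
have fI : forall x, [set` `]u, v[] x -> mu.-integrable `[0, 1] (EFin \o f x).
  by move=> x; rewrite /= in_itv /= => xuv; apply: Av_integrable => //; exact: sub.
have fD : forall x s, [set` `]u, v[] x -> [set` `[(0:R), 1]] s -> derivable (f ^~ s) x 1.
  by move=> x s; rewrite /= !in_itv /= => xuv s01; have [] := fd x s xuv s01.
have fB : forall x s, [set` `]u, v[] x -> [set` `[(0:R), 1]] s ->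
    `|partial1of2 f x s| <= cst (2 * B) s.
  move=> x s; rewrite /= !in_itv /= => xuv s01.
  rewrite partial1of2E; have [_ ->] := fd x s xuv s01.
  by apply: Av_norm_bound => //; apply: HB; exact: uv.
have iB : mu.-integrable `[0, 1] (EFin \o cst (2 * B)).
  by apply: cont_at_integrable => s _; exact: cst_continuous.
have B2 : forall s : R, 0 <= cst (2 * B) s by move=> s; rewrite mulr_ge0.
apply: DeriveDef.
  exact: (@derivable_under_integral R _ _ mu f `[0, 1] _ t u v tI fI fD _ B2 iB fB).
rewrite -derive1E.
rewrite (@differentiation_under_integral R _ _ mu f `[0, 1] _ t u v tI fI fD _ B2 iB fB) //.
apply: eq_Rintegral => s; rewrite inE /= in_itv /= => s01.
by rewrite partial1of2E; have [_ ->] := fd t s tuv s01.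
Qed.

(* The integrand is the derivative of [s ^+ k.+1 * H (t * s ^+ 2)]. *)
Lemma Av_inverse k H H' : (forall t : R, p < t < q -> is_derive t 1 H (H' t)) ->
  cont_on H' -> forall t : R, p < t < q ->
  Av k (fun r => k.+1%:R / 2 * H r + r * H' r) t = H t.
Proof.
move=> Hd Hc' t tpq.
have Hc : cont_on H by move=> s /Hd; exact: is_derive_cont.
pose K r := k.+1%:R / 2 * H r + r * H' r.
have Kc : cont_on K.
  move=> r rpq; exact: (cont_addf (cont_mulf (cont_cst _ _) (Hc _ rpq))
    (cont_mulf (cont_id r) (Hc' _ rpq))).
pose F (s : R) := s ^+ k.+1 * H (t * s ^+ 2).
have Fd (s : R) : 0 <= s <= 1 -> is_derive s 1 F (2 * s ^+ k * K (t * s ^+ 2)).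
  move=> s01; have ts := scale_sqr_between_lt p0q tpq s01.
  have d1 := is_derive_scalef t (is_derive_expf 2 (is_derive_id s 1)).
  have d2 := is_derive_mulf (is_derive_expf k.+1 (is_derive_id s 1))
    (@is_derive_compf R H (fun y : R => t * y ^+ 2) s _ _ (Hd _ ts) d1).
  by apply: (is_derive_eq d2); rewrite /K /= !exprS; field.
have := @continuous_FTC2 R (fun s => 2 * s ^+ k * K (t * s ^+ 2)) F 0 1 ltr01 _ _ _.
rewrite /Av /Rintegral => -> /=.
- by rewrite /F !expr1n mulr1 mul1r expr0n mul0r subr0.
- apply: continuous_in_subspaceT => s; rewrite inE /= in_itv /= => s01.
  exact: Av_integrand_cont.
- split.
  + move=> s; rewrite in_itv /= => /andP[s0 s1].
    by have [] := Fd s; rewrite ?ltW.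
  + apply: cvg_at_right_filter; apply: is_derive_cont; apply: Fd; lra.
  + apply: cvg_at_left_filter; apply: is_derive_cont; apply: Fd; lra.
- move=> s; rewrite in_itv /= => /andP[s0 s1].
  by rewrite derive1E; have [|_ ->] := Fd s; rewrite ?ltW.
Qed.

Lemma Av_linear k (a : R) H1 H2 t : cont_on H1 -> cont_on H2 -> p < t < q ->
  Av k (fun r => a * H1 r + r * H2 r) t = a * Av k H1 t + t * Av k.+2 H2 t.
Proof.
move=> c1 c2 tpq; rewrite /Av -!RintegralZl //; try exact: Av_integrable.
rewrite -RintegralD //.
- by apply: eq_Rintegral => s _; rewrite !exprS; ring.
- apply: cont_at_integrable => s s01.
  by apply: (cont_mulf (cont_cst _ _)); exact: Av_integrand_cont.
- apply: cont_at_integrable => s s01.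
  by apply: (cont_mulf (cont_cst _ _)); exact: Av_integrand_cont.
Qed.

End Averages.

Lemma bounded_cvg_Rintegral {R : realType} (a b C : R) (h_ : nat -> R -> R)
  (h : R -> R) :
  (forall k s, a <= s <= b -> {for s, continuous (h_ k)}) ->
  (forall s, a <= s <= b -> {for s, continuous h}) ->
  (forall k s, a <= s <= b -> `|h_ k s| <= C) ->
  (forall s, a <= s <= b -> h_ k s @[k --> \oo] --> h s) ->
  \int[@lebesgue_measure R]_(s in `[a, b]) h_ k s @[k --> \oo] -->
    \int[@lebesgue_measure R]_(s in `[a, b]) h s.
Proof.
move=> c_ c hC hl.
have inab s : [set` `[a, b]] s -> a <= s <= b by rewrite /= in_itv.
have i_ k := @cont_at_integrable R (h_ k) a b (c_ k).
have ih := @cont_at_integrable R h a b c.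
have [||||||_ _ L] := @dominated_convergence _ _ _ (@lebesgue_measure R) `[a, b]%classic
  _ (fun k s => (h_ k s)%:E) (fun s => (h s)%:E) (fun _ => C%:E).
- by [].
- by move=> k; have /integrableP[] := i_ k.
- by have /integrableP[] := ih.
- by apply: aeW => s /inab sab; apply/fine_cvgP; split; [exact: nearW|exact: hl].
- by apply: (@cont_at_integrable R (cst C) a b) => s _; exact: cst_continuous.
- by apply: aeW => s k /inab sab; rewrite lee_fin; exact: hC.
rewrite /Rintegral; apply: fine_cvg.
by rewrite fineK //; apply: integrable_fin_num.
Qed.

(** Radial comparisons are anchored at the right end, which stands for the boundary sphere, and
    follow from the sign of a derivative alone. *)
Lemma derive_le0_ge0 {R : realType} (a b : R) (F F' : R -> R) :
  (forall t : R, a <= t <= b -> is_derive t 1 F (F' t)) ->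
  (forall t : R, a <= t <= b -> F' t <= 0) -> 0 <= F b ->
  forall t : R, a <= t <= b -> 0 <= F t.
Proof.
move=> Fd F'0 Fb t /andP[at_]; rewrite le_eqVlt => /predU1P[-> //|tb].
have sub s : t <= s <= b -> a <= s <= b by lra.
have [s sab|c /andP[tc cb] E] := @is_derive_MVT R F F' t b tb.
  by apply: Fd; exact: sub.
rewrite (le_trans Fb) // -subr_le0 E mulr_le0_ge0 ?subr_ge0 ?(ltW tb) //.
by apply: F'0; rewrite (le_trans at_) ltW.
Qed.

(* The radial function [U (sqn x)] solves [- LapB u = f u] iff
   [U' t = - (1 - t) ^+ d.-1 * Av d H t] with [H t = (1 - t) ^- d.+1 * f (U t)],
   where [d.+1] is the dimension. Solving on [`[- e, t0]] rather than [`[0, t0]]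
   makes [U] of class C^2 near [t = 0], hence the solution C^2 at the origin. *)
Section FixedPoint.
Context {R : realType}.
Notation mu := (@lebesgue_measure R).
Variables (d : nat) (e t0 p q : R) (f f' w w1 w2 : R -> R).
Hypotheses (d_gt0 : (0 < d)%N) (e_gt0 : 0 < e) (t0_gt0 : 0 < t0) (t0_lt1 : t0 < 1).
Hypotheses (pe : p < - e) (t0q : t0 < q) (q1 : q <= 1).
(* [{for s, continuous f}] unfolds to a product, so that [s] would be made
   implicit, here and below. *)
Unset Implicit Arguments.
Hypothesis f_cont : forall s : R, {for s, continuous f}.
Set Implicit Arguments.
Hypothesis f_homo : {homo f : s t / s <= t}.
Hypothesis f_gt0 : forall s : R, 0 < f s.
Hypothesis f_d : forall s : R, 0 < s -> is_derive s 1 f (f' s).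
Hypothesis f'_cont : forall s : R, 0 < s -> {for s, continuous f'}.
Hypothesis w_d : forall t : R, p < t < q -> is_derive t 1 w (w1 t).
Hypothesis w1_d : forall t : R, p < t < q -> is_derive t 1 w1 (w2 t).
Hypothesis w2_cont : forall t : R, p < t < q -> {for t, continuous w2}.
Hypothesis w_super : forall t : R, - e <= t <= t0 ->
  f (w t) <= - ((1 - t) ^+ 2 * (t * w2 t + d.+1%:R / 2 * w1 t)
    + d.-1%:R * (1 - t) * t * w1 t).
Hypothesis w_t0 : 0 <= w t0.

(** Projection onto [- e, t0]. Composing with it extends functions controlled only there to
    continuous functions on the whole line, so that integrals and averages carry no side
    conditions. *)
Let c (t : R) : R := Num.max (- e) (Num.min t t0).
(** Base point of the integrals, strictly left of [- e], so that the fundamental theorem of calculus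
    applies at [- e] as well. *)
Let a : R := - e - 1.

Ltac slra := move: e_gt0 t0_gt0 t0_lt1 pe t0q q1 => ? ? ? ? ? ?; lra.

Let e_t0 : - e <= t0.
Proof. slra. Qed.

Let c_itv (t : R) : - e <= c t <= t0.
Proof. by rewrite /c le_max lexx /= ge_max e_t0 ge_min lexx orbT. Qed.

Let c_id (t : R) : - e <= t <= t0 -> c t = t.
Proof. by move=> /andP[et tt]; rewrite /c min_l // max_r. Qed.

Let c_idem (t : R) : c (c t) = c t.
Proof. by apply: c_id; exact: c_itv. Qed.

Unset Implicit Arguments.
Let c_cont (t : R) : {for t, continuous c}.
Proof.
apply: (@continuous_max _ _ (fun=> - e) (fun t => Num.min t t0)).
  exact: cvg_cst.
by apply: (@continuous_min _ _ id (fun=> t0)); [exact: cvg_id|exact: cvg_cst].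
Qed.
Set Implicit Arguments.

Let c1_gt0 (t : R) : 0 < 1 - c t.
Proof. by rewrite subr_gt0; case/andP: (c_itv t) => _ /le_lt_trans; apply. Qed.

Let gcont (g : R -> R) := forall t : R, {for t, continuous (fun t : R => g (c t))}.

Let src (g : R -> R) t : R := f (g (c t)) * (1 - c t)^-1 ^+ d.+1.

Let wgt (t : R) : R := (1 - c t)^-1 ^+ d.+1.

Let wgt_gt0 (t : R) : 0 < wgt t.
Proof. by rewrite exprn_gt0 // invr_gt0. Qed.

Unset Implicit Arguments.
Let c1_cont (t : R) : {for t, continuous (fun t : R => 1 - c t)}.
Proof. exact: (cont_addf (cont_cst 1 t) (cont_oppf (c_cont t))). Qed.
Set Implicit Arguments.

Unset Implicit Arguments.
Let wgt_cont (t : R) : {for t, continuous wgt}.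
Proof.
apply: cont_expf; apply: (@cvgV _ _ _ _ (fun t => 1 - c t)).
  by rewrite gt_eqF.
exact: c1_cont.
Qed.
Set Implicit Arguments.

Unset Implicit Arguments.
Let src_cont g : gcont g -> forall t : R, {for t, continuous (src g)}.
Proof.
move=> gc t; apply: (cont_mulf _ (wgt_cont t)).
by apply: (cont_compf (gc t)); exact: f_cont.
Qed.
Set Implicit Arguments.

Let src_ge0 g (t : R) : 0 <= src g t.
Proof. by rewrite mulr_ge0 // ltW // wgt_gt0. Qed.

Let src_le g g' : (forall t : R, - e <= t <= t0 -> g t <= g' t) ->
  forall t : R, src g t <= src g' t.
Proof.
move=> gg' t; rewrite ler_wpM2r ?(ltW (wgt_gt0 t)) //.
by apply: f_homo; apply: gg'; exact: c_itv.
Qed.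

Let slope g (t : R) : R := (1 - c t) ^+ d.-1 * Av d (src g) t.

Let around (t : R) : exists P Q : R, P < 0 < Q /\ P < t < Q.
Proof.
exists (- (`|t| + 1)), (`|t| + 1); have := normr_ge0 t; have := ler_norm t.
have := ler_norm (- t); rewrite normrN; slra.
Qed.

Unset Implicit Arguments.
Let slope_cont g : gcont g -> forall t : R, {for t, continuous (slope g)}.
Proof.
move=> gc t; have [P [Q [PQ tPQ]]] := around t.
apply: (cont_mulf (cont_expf _ (c1_cont t))).
by apply: (@Av_cont R P Q PQ) => // s _; exact: src_cont.
Qed.
Set Implicit Arguments.

Let slope_le g g' : gcont g -> gcont g' ->
  (forall t : R, - e <= t <= t0 -> g t <= g' t) ->
  forall t : R, slope g t <= slope g' t.
Proof.
move=> gc gc' gg' t; have [P [Q [PQ tPQ]]] := around t.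
rewrite ler_wpM2l ?exprn_ge0 ?(ltW (c1_gt0 t)) //.
apply: (@Av_le R P Q PQ) => //; try by move=> ? _; exact: src_cont.
by move=> s _; exact: src_le.
Qed.

Let slope_ge0 g (t : R) : 0 <= slope g t.
Proof.
rewrite mulr_ge0 ?exprn_ge0 ?(ltW (c1_gt0 t)) //.
apply: Rintegral_ge0 => s /=; rewrite in_itv /= => /andP[s0 _].
by rewrite mulr_ge0 // mulr_ge0 // exprn_ge0.
Qed.

(** The integral of [slope g] from [t] to [t0], written with a fixed lower end, the form that the
    fundamental theorem of calculus differentiates. *)
Let step g (t : R) : R :=
  \int[mu]_(s in `[a, t0]) slope g s - \int[mu]_(s in `[a, t]) slope g s.

Let step_t0 g : step g t0 = 0.
Proof. by rewrite /step subrr. Qed.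

Let step_d g : gcont g ->
  forall t : R, a < t -> is_derive t 1 (step g) (- slope g t).
Proof.
move=> gc t at_.
have tt1 : t < t + 1 by rewrite ltrDl.
have ii : mu.-integrable `[a, t + 1] (EFin \o slope g).
  by apply: cont_at_integrable => s _; exact: slope_cont.
have [D DE] := continuous_FTC1_closed tt1 ii at_ (slope_cont _ gc t).
have D2 : is_derive t 1 (fun x => \int[mu]_(s in `[a, x]) slope g s) (slope g t).
  by apply: DeriveDef; [exact: D|rewrite -derive1E; exact: DE].
apply: (is_derive_eq (is_derive_subf (is_derive_cst _ _ _) D2)).
by rewrite sub0r.
Qed.

Let a_lt (t : R) : - e <= t <= t0 -> a < t.
Proof. rewrite /a; slra. Qed.

Let gcont_d g (h : R -> R) :
  (forall t : R, - e <= t <= t0 -> is_derive t 1 g (h t)) -> gcont g.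
Proof.
move=> gd t; apply: (cont_compf (c_cont t)).
by have := is_derive_cont (gd _ (c_itv t)).
Qed.

Unset Implicit Arguments.
Let step_gcont g : gcont g -> gcont (step g).
Proof.
by move=> gc; apply: (@gcont_d _ (fun t => - slope g t)) => t /a_lt; exact: step_d.
Qed.
Set Implicit Arguments.

Let step_le g g' : gcont g -> gcont g' ->
  (forall t : R, - e <= t <= t0 -> g t <= g' t) ->
  forall t : R, - e <= t <= t0 -> step g t <= step g' t.
Proof.
move=> gc gc' gg' t tI; rewrite -subr_ge0.
apply: (@derive_le0_ge0 R (- e) t0 (fun t => step g' t - step g t)
  (fun t => - slope g' t - - slope g t)) => //.
- by move=> s /a_lt sa; apply: is_derive_subf; apply: step_d.
- by move=> s _; rewrite opprK addrC subr_le0 slope_le.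
- by rewrite !step_t0 subrr.
Qed.

Let step_ge0 g : gcont g -> forall t : R, - e <= t <= t0 -> 0 <= step g t.
Proof.
move=> gc; apply: (@derive_le0_ge0 R (- e) t0 _ (fun t => - slope g t)).
- by move=> s /a_lt sa; apply: step_d.
- by move=> s _; rewrite oppr_le0 slope_ge0.
- by rewrite step_t0.
Qed.

Let pq (t : R) : - e <= t <= t0 -> p < t < q.
Proof. slra. Qed.

Let p0q : p < 0 < q.
Proof. slra. Qed.

Unset Implicit Arguments.
Let w_gcont : gcont w.
Proof. by apply: (@gcont_d _ w1) => t /pq; exact: w_d. Qed.
Set Implicit Arguments.

(** The power of 1 - t is an integrating factor: it absorbs the term [d.-1%:R * (1 - t) * t * w1 t],
    and the operator becomes d.+1 / 2 * y + t * y', which [Av d] inverts. *)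
Let y (t : R) : R := - w1 t * (1 - t)^-1 ^+ d.-1.
Let y' (t : R) : R := - w2 t * (1 - t)^-1 ^+ d.-1
  - d.-1%:R * w1 t * (1 - t)^-1 ^+ d.

Let t1_neq0 (t : R) : p < t < q -> 1 - t != 0.
Proof. by move=> /andP[_ tq]; rewrite subr_eq0 gt_eqF // (lt_le_trans tq). Qed.

Let w1_cont (t : R) : p < t < q -> {for t, continuous w1}.
Proof. by move=> /w1_d; exact: is_derive_cont. Qed.

Let y_d : forall t : R, p < t < q -> is_derive t 1 y (y' t).
Proof.
move=> t tpq; have t1 := t1_neq0 tpq.
have D := is_derive_mulf (is_derive_oppf (w1_d tpq)) (is_derive_onem_inv_exp d.-1 t1).
apply: (is_derive_eq D); rewrite /y' prednK //; ring.
Qed.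

Let y'_cont : forall t : R, p < t < q -> {for t, continuous y'}.
Proof.
move=> t tpq; have t1 := t1_neq0 tpq.
have ic k := is_derive_cont (is_derive_onem_inv_exp k t1).
apply: cont_addf.
  exact: (cont_mulf (cont_oppf (w2_cont tpq)) (ic _)).
apply: cont_oppf; apply: (cont_mulf _ (ic _)).
exact: (cont_mulf (cont_cst _ _) (w1_cont tpq)).
Qed.

(** [Av_inverse] presents [- w1] as an average of the operator applied to [w], and [w_super]
    compares the integrands. The segment from 0 to [t] stays in [- e, t0], where [w_super] is
    available. *)
Let slope_w : forall t : R, - e <= t <= t0 -> slope w t <= - w1 t.
Proof.
move=> t tI; have tpq := pq tI; have t1 := t1_neq0 tpq.
have -> : - w1 t = (1 - c t) ^+ d.-1 * y t.
  rewrite c_id // /y exprVn; field; exact: expf_neq0.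
rewrite ler_wpM2l ?exprn_ge0 ?(ltW (c1_gt0 t)) //.
rewrite -(Av_inverse p0q d y_d y'_cont tpq).
apply: (Av_le p0q) => //.
- by move=> s _; exact: src_cont.
- move=> s spq; apply: cont_addf.
    exact: (cont_mulf (cont_cst _ _) (is_derive_cont (y_d spq))).
  exact: (cont_mulf (cont_id _) (y'_cont spq)).
- move=> s s01; have sI : - e <= t * s ^+ 2 <= t0.
    by apply: scale_sqr_between => //; slra.
  move: (t * s ^+ 2) sI => r rI; have r1 := t1_neq0 (pq rI).
  rewrite /src c_id // (_ : d.+1%:R / 2 * y r + r * y' r =
    (- ((1 - r) ^+ 2 * (r * w2 r + d.+1%:R / 2 * w1 r)
    + d.-1%:R * (1 - r) * r * w1 r)) * (1 - r)^-1 ^+ d.+1); last first.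
    have vd : (1 - r)^-1 ^+ d = (1 - r)^-1 * (1 - r)^-1 ^+ d.-1.
      by rewrite -exprS prednK.
    rewrite /y /y' [_ ^+ d.+1]exprS vd; move: (_ ^+ d.-1) => z; by field.
  apply: ler_wpM2r; last exact: w_super.
  by have := ltW (wgt_gt0 r); rewrite /wgt c_id.
Qed.

Let step_w : forall t : R, - e <= t <= t0 -> step w t <= w t.
Proof.
move=> t tI; rewrite -subr_ge0.
apply: (@derive_le0_ge0 R (- e) t0 (fun t => w t - step w t)
  (fun t => w1 t - - slope w t)) => //.
- move=> s sI.
  have D1 := w_d (pq sI).
  have D2 := step_d w_gcont (a_lt sI).
  exact: (is_derive_subf D1 D2).
- by move=> s /slope_w H; rewrite opprK; lra.
- by rewrite step_t0 subr0.
Qed.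

(** * Monotone iteration from 0 and its limit *)

Let iter_ k : R -> R := iter k step (fun=> 0).

Unset Implicit Arguments.
Let iter_gcont k : gcont (iter_ k).
Proof.
by elim: k => [|k IH]; [move=> t; exact: cvg_cst|exact: step_gcont].
Qed.
Set Implicit Arguments.

Let iter_le k t : - e <= t <= t0 -> iter_ k t <= iter_ k.+1 t.
Proof.
elim: k t => [|k IH] t tI; first exact: (step_ge0 (iter_gcont 0)).
exact: step_le (iter_gcont k) (iter_gcont k.+1) IH t tI.
Qed.

Let w_ge0 (t : R) : - e <= t <= t0 -> 0 <= w t.
Proof. by move=> tI; apply: le_trans (step_w tI); exact: step_ge0. Qed.

Let iter_w k t : - e <= t <= t0 -> iter_ k t <= w t.
Proof.
elim: k t => [|k IH] t tI; first exact: w_ge0.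
apply: le_trans (step_w tI).
exact: step_le (iter_gcont k) w_gcont IH t tI.
Qed.

Let iter_nd (t : R) : nondecreasing_seq (fun k => iter_ k (c t)).
Proof. by apply/nondecreasing_seqP => k; apply: iter_le; exact: c_itv. Qed.

Let sol (t : R) : R := limn (fun k => iter_ k (c t)).

Let iter_cvg (t : R) : iter_ k (c t) @[k --> \oo] --> sol t.
Proof.
apply: nondecreasing_is_cvgn (@iter_nd t) _.
by exists (w (c t)) => _ [k _ <-]; apply: iter_w; exact: c_itv.
Qed.

Let sol_c (t : R) : sol (c t) = sol t.
Proof. by rewrite /sol c_idem. Qed.

Let slope_bound : exists2 B : R, 0 <= B & forall k t, - e <= t <= t0 ->
  `|slope (iter_ k) t| <= B.
Proof.
have [||B B0 HB] := @cont_at_bounded R (slope w) (- e) t0 => //.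
  by move=> s _; exact: slope_cont.
exists B => // k t tI; rewrite ger0_norm ?slope_ge0 //.
apply: le_trans (HB t tI); apply: le_trans (ler_norm _).
by apply: slope_le => // s sI; exact: iter_w.
Qed.

Unset Implicit Arguments.
(** The slopes of all iterates are bounded by that of [w], so the iterates share a Lipschitz
    constant, which passes to the pointwise limit. *)
Let sol_gcont : gcont sol.
Proof.
have [B B0 HB] := slope_bound.
have lip0 k s t : - e <= s -> s < t -> t <= t0 ->
    `|iter_ k t - iter_ k s| <= B * `|t - s|.
  move=> es st tt; case: k => [|k].
    by rewrite subrr normr0 mulr_ge0.
  have sub r : s <= r <= t -> - e <= r <= t0 by slra.
  have [r sr|r /andP[sr rt] E] := @is_derive_MVT R (step (iter_ k))
      (fun t => - slope (iter_ k) t) s t st.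
    by apply: step_d => //; apply: a_lt; exact: sub.
  rewrite -[iter_ k.+1]/(step (iter_ k)) E normrM normrN ler_wpM2r // HB //.
  by apply: sub; rewrite !ltW.
have lip k s t : - e <= s <= t0 -> - e <= t <= t0 ->
    `|iter_ k s - iter_ k t| <= B * `|s - t|.
  move=> sI tI; have [st|ts|->] := ltgtP s t.
  - by rewrite distrC [`|s - t|]distrC; apply: lip0 => //; slra.
  - by apply: lip0 => //; slra.
  - by rewrite !subrr normr0 mulr0.
have solL s t : `|sol s - sol t| <= B * `|c s - c t|.
  have L : `|iter_ k (c s) - iter_ k (c t)| @[k --> \oo] --> `|sol s - sol t|.
    by apply: cvg_norm; apply: cvgB; exact: iter_cvg.
  apply: (cvgr_to_le L); apply: nearW => k; apply: lip; exact: c_itv.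
move=> t; have -> : (fun t => sol (c t)) = sol by apply/funext => s; exact: sol_c.
apply/cvgrPdist_lt => eps eps0.
have B1 : 0 < B + 1 by rewrite ltr_wpDl.
have := c_cont t; move/cvgrPdist_lt => /(_ (eps / (B + 1))).
rewrite divr_gt0 // => /(_ isT); apply: filterS => s H.
apply: le_lt_trans (solL _ _) _.
apply: (@le_lt_trans _ _ ((B + 1) * `|c t - c s|)).
  by rewrite ler_wpM2r // lerDl.
by rewrite mulrC -ltr_pdivlMr.
Qed.
Set Implicit Arguments.

Let src_cvg (t : R) : src (iter_ k) t @[k --> \oo] --> src sol t.
Proof.
apply: cvgM; last exact: cvg_cst.
rewrite sol_c; apply: (@cvg_comp _ _ _ (fun k => iter_ k (c t)) f _ _ _ (@iter_cvg t)).
exact: f_cont.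
Qed.

Let src_bound : exists B, forall k t, `|src (iter_ k) t| <= B.
Proof.
have [||B B0 HB] := @cont_at_bounded R (src w) (- e) t0 => //.
  by move=> s _; exact: src_cont.
exists B => k t; rewrite ger0_norm ?src_ge0 //.
have <- : src (iter_ k) (c t) = src (iter_ k) t by rewrite /src c_idem.
apply: le_trans (HB (c t) (c_itv t)); apply: le_trans (ler_norm _).
by apply: src_le => s sI; exact: iter_w.
Qed.

Let slope_cvg (t : R) : slope (iter_ k) t @[k --> \oo] --> slope sol t.
Proof.
apply: cvgM; first exact: cvg_cst.
have [B HB] := src_bound; have [P [Q [PQ tPQ]]] := around t.
apply: (@bounded_cvg_Rintegral R 0 1 (2 * B)).
- move=> k s s01; apply: (Av_integrand_cont PQ) => // r _.
  exact: src_cont _ (iter_gcont k) r.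
- by move=> s s01; apply: (Av_integrand_cont PQ) => // r _; exact: src_cont.
- by move=> k s s01; exact: Av_norm_bound.
- by move=> s _; apply: cvgM; [exact: cvg_cst|exact: src_cvg].
Qed.

(** The integrals in [step] start at [a], outside [- e, t0], so the dominating constant must hold
    beyond that interval; the projection [c] gives 0 < 1 - c t <= 1 + e everywhere. *)
Let slope_global_bound : exists B, forall k t, `|slope (iter_ k) t| <= B.
Proof.
have [B HB] := src_bound; exists ((1 + e) ^+ d.-1 * (2 * B)) => k t.
have B0 : 0 <= B by apply: le_trans (HB 0%N 0).
rewrite normrM; apply: ler_pM => //.
  rewrite normrX lerXn2r ?nnegrE ?addr_ge0 ?(ltW e_gt0) //.
  rewrite gtr0_norm ?c1_gt0 //; have := c_itv t; slra.
have [P [Q [PQ tPQ]]] := around t.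
have I := @Av_integrable R P Q PQ d (src (iter_ k)) t
  (fun s _ => src_cont _ (iter_gcont k) s) tPQ.
apply: le_trans (le_normr_Rintegral _ I) _ => //.
have -> : 2 * B = \int[mu]_(s in `[0, 1]) (2 * B).
  rewrite Rintegral_cst // /= lebesgue_measure_itv /= lte_fin ltr01.
  by rewrite /= oppr0 addr0 mulr1.
apply: le_Rintegral => //.
- by have /integrable_norm := I.
- by apply: cont_at_integrable => s _; exact: cvg_cst.
- by move=> s /=; rewrite in_itv /= => s01; exact: Av_norm_bound.
Qed.

Let step_sol (t : R) : - e <= t <= t0 -> sol t = step sol t.
Proof.
move=> tI; have [B HB] := slope_global_bound.
have int_cvg (x : R) : \int[mu]_(s in `[a, x]) slope (iter_ k) s @[k --> \oo] -->
    \int[mu]_(s in `[a, x]) slope sol s.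
  apply: (@bounded_cvg_Rintegral R a x B).
  - by move=> k s _; exact: slope_cont _ (iter_gcont k) s.
  - by move=> s _; exact: slope_cont.
  - by move=> k s _; exact: HB.
  - by move=> s _; exact: slope_cvg.
have L : step (iter_ k) t @[k --> \oo] --> step sol t by apply: cvgB; exact: int_cvg.
have L' := @iter_cvg t; rewrite (c_id tI) in L'.
have L2 : iter_ k.+1 t @[k --> \oo] --> sol t by rewrite (cvg_shiftS (fun k => iter_ k t)).
exact: (cvg_unique _ L2 L).
Qed.

(** * Positivity and smoothness of the limit *)

Let src_lower : exists2 m : R, 0 < m & forall t : R, m <= src sol t.
Proof.
have sol_ge0 t : 0 <= sol t.
  apply: (cvgr_to_ge (@iter_cvg t)); apply: nearW => k.
  by rewrite (le_trans _ (@iter_nd t 0%N k (leq0n k))).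
exists (f 0 * (1 + e)^-1 ^+ d.+1).
  by rewrite mulr_gt0 // exprn_gt0 // invr_gt0 addr_gt0.
move=> t; apply: ler_pM => //.
- by rewrite ltW.
- by rewrite exprn_ge0 // invr_ge0 addr_ge0 // ltW.
- exact: f_homo.
- have e1 : 0 <= 1 + e by rewrite addr_ge0 // ltW.
  apply: lerXn2r; rewrite ?nnegrE ?invr_ge0 ?(ltW (c1_gt0 t)) //.
  rewrite lef_pV2 ?posrE ?c1_gt0 ?addr_gt0 //.
  by have := c_itv t; slra.
Qed.

Let slope_sol_gt0 (t : R) : 0 < slope sol t.
Proof.
have [m m0 Hm] := src_lower; have [P [Q [PQ tPQ]]] := around t.
rewrite mulr_gt0 ?exprn_gt0 //.
(* The value of [Av d] on the constant [m], obtained below by applying [Av_inverse] to a constant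
   function. *)
pose m' := 2 * m / d.+1%:R.
have m'0 : 0 < m' by rewrite divr_gt0 // mulr_gt0.
apply: (lt_le_trans m'0).
have <- : Av d (fun r => d.+1%:R / 2 * m' + r * 0) t = m'.
  by apply: (@Av_inverse R P Q PQ d (fun=> m') (fun=> 0)) => // s _; exact: cvg_cst.
apply: (Av_le PQ) => //.
- move=> s _; apply: cont_addf; first exact: cvg_cst.
  exact: (cont_mulf (cont_id _) (cont_cst _ _)).
- by move=> s _; exact: src_cont.
- move=> s _; apply: le_trans (Hm _); rewrite mulr0 addr0 /m'.
  by rewrite le_eqVlt; apply/orP; left; apply/eqP; field; rewrite gt_eqF // addr_gt0.
Qed.

(** [f] is assumed differentiable at positive arguments only, so strict positivity left of [t0] is
    what makes the source differentiable there. *)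
Let step_sol_gt0 (t : R) : - e <= t < t0 -> 0 < step sol t.
Proof.
move=> /andP[et tt].
have [s sI|r /andP[tr rt] E] := @is_derive_MVT R (step sol)
    (fun t => - slope sol t) t t0 tt.
  by apply: step_d => //; apply: a_lt; slra.
move: E; rewrite step_t0 sub0r mulNr => /oppr_inj ->.
by rewrite mulr_gt0 // subr_gt0.
Qed.

Let src' (t : R) : R := f' (step sol t) * (- slope sol t) * (1 - t)^-1 ^+ d.+1
  + f (step sol t) * (d.+1%:R * (1 - t)^-1 ^+ d.+2).

Let I_neq0 (t : R) : - e < t < t0 -> 1 - t != 0.
Proof. by move=> tI; rewrite subr_eq0 gt_eqF; slra. Qed.

Let src_d : forall t : R, - e < t < t0 -> is_derive t 1 (src sol) (src' t).
Proof.
move=> t tI; have t1 := I_neq0 tI.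
apply: (@near_eq_is_derive _ _ _ (fun t => f (step sol t) * (1 - t)^-1 ^+ d.+1)).
  have := near_itv_oo tI; apply: filterS => s sI.
  have sI' : - e <= s <= t0 by slra.
  by rewrite /src c_id // step_sol.
have sa : a < t by apply: a_lt; slra.
have s0 : 0 < step sol t by apply: step_sol_gt0; slra.
have D := is_derive_mulf (@is_derive_compf R f (step sol) t _ _ (f_d s0)
  (step_d sol_gcont sa)) (is_derive_onem_inv_exp d.+1 t1).
by apply: (is_derive_eq D); rewrite /src'; ring.
Qed.

Let src'_cont : forall t : R, - e < t < t0 -> {for t, continuous src'}.
Proof.
move=> t tI; have t1 := I_neq0 tI.
have ic k := is_derive_cont (is_derive_onem_inv_exp k t1).
have sa : a < t by apply: a_lt; slra.
have s0 : 0 < step sol t by apply: step_sol_gt0; slra.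
have stc := is_derive_cont (step_d sol_gcont sa).
apply: cont_addf.
  apply: (cont_mulf _ (ic _)).
  apply: (cont_mulf (cont_compf stc (f'_cont s0))).
  exact/cont_oppf/slope_cont.
apply: (cont_mulf (cont_compf stc (f_cont _))).
exact: (cont_mulf (cont_cst _ _) (ic _)).
Qed.

Lemma radial_solution : exists U U1 U2 : R -> R,
  [/\ forall t : R, - e < t < t0 ->
        is_derive t 1 U (U1 t) /\ is_derive t 1 U1 (U2 t),
      forall t : R, - e < t < t0 -> {for t, continuous U2},
      forall t : R, 0 <= t <= t0 -> {for t, continuous U},
      forall t : R, - e < t < t0 -> 0 < U t /\
        f (U t) = - ((1 - t) ^+ 2 * (t * U2 t + d.+1%:R / 2 * U1 t)
          + d.-1%:R * (1 - t) * t * U1 t) &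
      U t0 = 0].
Proof.
have ee0 : - e < 0 < t0 by slra.
have Ad := Av_derive ee0 d src_d src'_cont.
have Ac := @Av_cont R (- e) t0 ee0 d.+2 src' src'_cont.
have pd (t : R) k : is_derive t 1 (fun t : R => (1 - t) ^+ k) (- (k%:R * (1 - t) ^+ k.-1)).
  have d1 : is_derive t 1 (fun t : R => 1 - t) (0 - 1).
    exact: (is_derive_subf (is_derive_cst _ _ _) (is_derive_id _ _)).
  by apply: (is_derive_eq (is_derive_expf k d1)); ring.
exists (step sol), (fun t => - ((1 - t) ^+ d.-1 * Av d (src sol) t)),
  (fun t => - ((1 - t) ^+ d.-1 * Av d.+2 src' t
    + Av d (src sol) t * - (d.-1%:R * (1 - t) ^+ d.-2))).
have cI t : - e < t < t0 -> - e <= t <= t0 by slra.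
split.
- move=> t tI; split; last exact: (is_derive_oppf (is_derive_mulf (pd _ _) (Ad _ tI))).
  have := step_d sol_gcont (a_lt (cI _ tI)).
  by rewrite /slope c_id // cI.
- move=> t tI; apply: cont_oppf; apply: cont_addf.
    exact: (cont_mulf (is_derive_cont (pd _ _)) (Ac _ tI)).
  apply: (cont_mulf (is_derive_cont (Ad _ tI))); apply: cont_oppf.
  exact: (cont_mulf (cont_cst _ _) (is_derive_cont (pd _ _))).
- move=> t tI; apply: (@is_derive_cont _ _ _ (- slope sol t)).
  by apply: step_d => //; apply: a_lt; slra.
- move=> t tI; split; first by apply: step_sol_gt0; slra.
  have t1 := I_neq0 tI.
  (* Split by [Av_linear], this says that the source is d.+1 / 2 times [Av d] of itself plus t times
     [Av d.+2] of its derivative: the equation, up to a power of 1 - t. *)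
  have E := Av_inverse ee0 d src_d src'_cont tI.
  rewrite (Av_linear ee0) // in E; last by move=> s /src_d; exact: is_derive_cont.
  have -> : f (step sol t) = src sol t * (1 - t) ^+ d.+1.
    rewrite /src c_id ?cI // -step_sol ?cI // exprVn; field.
    exact: expf_neq0.
  (* The exponent [d.-2] is truncated at d = 1, but its coefficient [d.-1%:R] vanishes there, hence
     the separate case. *)
  rewrite -E; case: d d_gt0 => // [[|k]] _ /=; rewrite !exprS; ring.
- exact: step_t0.
Qed.

End FixedPoint.

(** * Comparison with the singular solution *)

Section Sh2.
Context {R : realType}.
Implicit Types (t z : R).

Lemma sh2_lt (a b : R) : -1 < a -> a < b -> b < 1 -> sh2 a < sh2 b :> R.
Proof.
move=> a1 ab b1; rewrite /sh2.
have pa : 0 < (1 - a) ^+ 2 by rewrite exprn_gt0 //; lra.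
have pb : 0 < (1 - b) ^+ 2 by rewrite exprn_gt0 //; lra.
rewrite ltr_pdivrMr // mulrAC ltr_pdivlMr //.
(* This product equals b * (1 - a)^2 - a * (1 - b)^2. *)
have : 0 < (b - a) * (1 - a * b) by rewrite mulr_gt0 //; nra.
nra.
Qed.

Lemma sh2_ge t : t <= 0 -> 4 * t <= sh2 t.
Proof.
move=> t0; rewrite /sh2 ler_pdivlMr; last by rewrite exprn_gt0 //; lra.
have : 1 <= (1 - t) ^+ 2 by rewrite expr_ge1 //; lra.
nra.
Qed.

Lemma sh2_0 : sh2 0 = 0 :> R.
Proof. by rewrite /sh2 mulr0 mul0r. Qed.

Lemma sh2_gt0 t : 0 < t < 1 -> 0 < sh2 t.
Proof. by move=> /andP[t0 t1]; rewrite -sh2_0; apply: sh2_lt => //; lra. Qed.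

Lemma sh2_le (a b : R) : -1 < a -> a <= b -> b < 1 -> sh2 a <= sh2 b.
Proof.
by move=> a1; rewrite le_eqVlt => /predU1P[-> //|ab b1]; apply/ltW/sh2_lt.
Qed.

Let onem_neq0 t : t != 1 -> 1 - t != 0.
Proof. by rewrite subr_eq0 eq_sym. Qed.

Definition sh2_1 t : R := 4 * (1 + t) * (1 - t)^-1 ^+ 3.
Definition sh2_2 t : R := (16 + 8 * t) * (1 - t)^-1 ^+ 4.

Lemma sh2_d t : t != 1 -> is_derive t 1 (@sh2 R) (sh2_1 t).
Proof.
move=> t1; have d := is_derive_mulf (is_derive_scalef 4 (is_derive_id t 1))
  (is_derive_onem_inv_exp 2 (onem_neq0 t1)).
rewrite (_ : @sh2 R = (fun y : R => 4 * y * (1 - y)^-1 ^+ 2)); last first.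
  by apply/funext => y; rewrite /sh2 exprVn.
apply: (is_derive_eq d); rewrite /sh2_1; field.
by rewrite subr_eq0 eq_sym.
Qed.

Lemma sh2_1_d t : t != 1 -> is_derive t 1 sh2_1 (sh2_2 t).
Proof.
move=> t1; have d := is_derive_mulf (is_derive_scalef 4 (is_derive_addf
  (is_derive_cst (1 : R) t 1) (is_derive_id t 1))) (is_derive_onem_inv_exp 3 (onem_neq0 t1)).
apply: (is_derive_eq d); rewrite /sh2_2 /=; field.
by rewrite subr_eq0 eq_sym.
Qed.

Lemma sh2_2_cont t : t != 1 -> {for t, continuous sh2_2}.
Proof.
move=> t1; apply: cont_mulf; last first.
  exact: is_derive_cont (is_derive_onem_inv_exp 4 (onem_neq0 t1)).
exact: (cont_addf (cont_cst _ _) (cont_mulf (cont_cst _ _) (cont_id _))).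
Qed.

Lemma powR_pred z r : 0 < z -> z `^ (r - 1) = z `^ r / z.
Proof.
by move=> z0; rewrite powRB ?powRr1 ?ltW //; apply/implyP => _; rewrite gt_eqF.
Qed.

Variables (n : nat) (a b : R) (H H1 H2 : R -> R).
Hypothesis b1 : b <= 1.
Hypothesis H_d : forall t : R, a < t < b -> is_derive (sh2 t) 1 H (H1 (sh2 t)).
Hypothesis H1_d : forall t : R, a < t < b -> is_derive (sh2 t) 1 H1 (H2 (sh2 t)).

Let G1 (t : R) : R := H1 (sh2 t) * sh2_1 t.
Let G2 (t : R) : R := H1 (sh2 t) * sh2_2 t + sh2_1 t * (H2 (sh2 t) * sh2_1 t).

Let t_neq1 t : a < t < b -> t != 1.
Proof. by move=> /andP[_ tb]; rewrite lt_eqF // (lt_le_trans tb). Qed.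

Lemma comp_sh2_d (t : R) : a < t < b -> is_derive t 1 (fun t => H (sh2 t)) (G1 t).
Proof. by move=> tab; apply: (is_derive_compf (H_d tab)); exact/sh2_d/t_neq1. Qed.

Lemma comp_sh2_1_d (t : R) : a < t < b -> is_derive t 1 G1 (G2 t).
Proof.
move=> tab; have t1 := t_neq1 tab.
exact: (is_derive_mulf (is_derive_compf (H1_d tab) (sh2_d t1)) (sh2_1_d t1)).
Qed.

Hypothesis H2_c : forall t, a < t < b -> {for sh2 t, continuous H2}.

Lemma comp_sh2_2_cont (t : R) : a < t < b -> {for t, continuous G2}.
Proof.
move=> tab; have t1 := t_neq1 tab; have c0 := is_derive_cont (sh2_d t1).
have c1 := is_derive_cont (sh2_1_d t1).
apply: cont_addf.
  exact: (cont_mulf (cont_compf c0 (is_derive_cont (H1_d tab))) (sh2_2_cont t1)).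
exact: (cont_mulf c1 (cont_mulf (cont_compf c0 (H2_c tab)) c1)).
Qed.

(** The polynomial coefficients in z are the point of this change of variable: a power of z is sent
    to a combination of two consecutive powers. *)
Lemma comp_sh2_ode (N : R) (t : R) : a < t < b ->
  (1 - t) ^+ 2 * (t * G2 t + N / 2 * G1 t) + (N - 2) * (1 - t) * t * G1 t =
  4 * sh2 t * (1 + sh2 t) * H2 (sh2 t)
  + (2 * N * (1 + sh2 t) + 2 * sh2 t) * H1 (sh2 t).
Proof.
move=> tab; have t1 := t_neq1 tab; rewrite /G2 /G1.
move: (H1 _) (H2 _) => h1 h2; rewrite /sh2 /sh2_1 /sh2_2; field.
by rewrite subr_eq0 eq_sym.
Qed.

Lemma C2_sh2 (A : set 'rV[R]_n) : (forall x, A x -> a < sqn x < b) ->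
  C2_on A (fun x => H (sh2 (sqn x))).
Proof.
move=> Aab; apply: (@C2_radial R n a b (fun t => H (sh2 t)) G1 G2) => //.
- exact: comp_sh2_d.
- exact: comp_sh2_1_d.
- exact: comp_sh2_2_cont.
Qed.

Lemma LapB_sh2 (x : 'rV[R]_n) : a < sqn x < b ->
  LapB (fun x => H (sh2 (sqn x))) x =
  4 * sh2 (sqn x) * (1 + sh2 (sqn x)) * H2 (sh2 (sqn x))
  + (2 * n%:R * (1 + sh2 (sqn x)) + 2 * sh2 (sqn x)) * H1 (sh2 (sqn x)).
Proof.
move=> xab; rewrite -(comp_sh2_ode n%:R xab).
by rewrite (@LapB_radial R n a b (fun t => H (sh2 t)) G1 G2 comp_sh2_d comp_sh2_1_d).
Qed.

End Sh2.

Lemma powR_cont {R : realType} (r z : R) : 0 < z ->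
  {for z, continuous (fun z : R => z `^ r)}.
Proof. by move=> z0; apply: is_derive_cont; exact: is_derive1_powR. Qed.

Lemma powR_le0_anti {R : realType} (r x y : R) : r <= 0 -> 0 < x -> x <= y ->
  y `^ r <= x `^ r.
Proof.
move=> r0 x0 xy; have y0 := lt_le_trans x0 xy.
rewrite -[r]opprK powRN [X in _ <= X]powRN lef_pV2 ?posrE ?powR_gt0 //.
by apply: ge0_ler_powR; rewrite ?oppr_ge0 // nnegrE ltW.
Qed.

Lemma powR_ge1 {R : realType} (r x : R) : 0 <= r -> 1 <= x -> 1 <= x `^ r.
Proof.
move=> r0 x1; have -> : (1 : R) = 1 `^ r by rewrite powR1.
by apply: ge0_ler_powR; rewrite ?nnegrE // (le_trans ler01).
Qed.

(** * Extremal parameter and solution for a singular solution with power-like derivative *)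

Section Extremal.
Context {R : realType} {n : nat}.
Variables (rho : R) (f f' W V : R -> R) (A al K Cg kap c : R).
Let N : R := n%:R - 2.
(** The critical Hardy exponent: z^-gam behaves like r^(-(n - 2) / 2) near the origin. *)
Let gam : R := N / 4.
(** Applying the operator to [W] gives - Delta W = z^(-al - 1) * (2 * A * (N - 2 * al) + 2 * A * (N
    + 1 - 2 * al) * z). With [LK] and [fU] the two coefficients are [L] and [L * K], so this is L *
    f (U z). *)
Let L : R := 2 * A * (N - 2 * al).
Let Z0 : R := sinhR rho ^+ 2.
Let T : R := tmax rho.
Let U (z : R) : R := W z - W Z0.
Hypotheses (n3 : (3 <= n)%N) (rho_gt0 : 0 < rho) (A_gt0 : 0 < A) (al_ge0 : 0 <= al).
Hypotheses (K_gt0 : 0 < K) (c_gt0 : 0 < c) (L_gt0 : 0 < L).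
Hypothesis LK : L * K = 2 * A * (N + 1 - 2 * al).
Hypothesis al_gam : al + 1 <= gam.
Hypothesis kap_gam : kap < gam.
Hypothesis W_d : forall z : R, 0 < z -> is_derive z 1 W (- A * z `^ (- al - 1)).
Hypothesis fU : forall z, 0 < z <= Z0 -> f (U z) = z `^ (- al - 1) * (1 + K * z).
(** The right side is the formula of [fU] at [z + dl], times a factor tending to 1 with [dl]. The
    factor pays for subtracting [W (Z0 + dl)] while [f] stays adapted to [W Z0]. *)
Hypothesis f_shift : forall dl z, 0 < dl -> - dl < z <= Z0 ->
  f (W (z + dl) - W (Z0 + dl)) <=
  (1 + dl / Z0) `^ (al + 1) * ((z + dl) `^ (- al - 1) * (1 + K * (z + dl))).
(** [V z] stands for f' (U z): the graph of [f] lies above its tangent at [U z]. *)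
Hypothesis f_convex : forall z s, 0 < z <= Z0 -> 0 <= s ->
  f (U z) - f s <= V z * (U z - s).
(* The stability of [U], by Hardy's inequality with weight [z ^ - gam]. *)
Hypothesis V_hardy : forall z, 0 < z <= Z0 ->
  L * V z * z <= N ^+ 2 / 4 + z * (N * (N + 2) / 4 - c).
Hypothesis U_growth : forall z, 0 < z <= Z0 -> U z <= Cg * z `^ (- kap).
Hypothesis f_cont : forall s : R, 0 <= s -> {for s, continuous f}.
Hypothesis f_homo : forall s t, 0 <= s -> s <= t -> f s <= f t.
Hypothesis f_gt0 : forall s, 0 <= s -> 0 < f s.
Hypothesis f_d : forall s : R, 0 < s -> is_derive s 1 f (f' s).
Hypothesis f'_cont : forall s : R, 0 < s -> {for s, continuous f'}.

Let Z0_gt0 : 0 < Z0.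
Proof. by rewrite exprn_gt0 // sinhR_gt0. Qed.

Let T_bounds : 0 < T < 1.
Proof. exact: tmax_bounds. Qed.

Let sh2_T : sh2 T = Z0.
Proof. exact: sh2_tmax. Qed.

Let N_gt0 : 0 < N.
Proof. by rewrite subr_gt0 ltr_nat. Qed.

Let W1 (z : R) : R := - A * z `^ (- al - 1).
Let W2 (z : R) : R := A * (al + 1) * z `^ (- al - 2).

Let W1_d (z : R) : 0 < z -> is_derive z 1 W1 (W2 z).
Proof.
move=> z0; have D := is_derive_scalef (- A) (is_derive1_powR (- al - 1) z0).
apply: (is_derive_eq D); rewrite /W2 (_ : - al - 1 - 1 = - al - 2); ring.
Qed.

Let W2_cont (z : R) : 0 < z -> {for z, continuous W2}.
Proof. by move=> z0; apply: (cont_mulf (cont_cst _ _)); exact: powR_cont. Qed.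

Let shift_d (g g1 : R -> R) (dl z : R) : is_derive (z + dl) 1 g (g1 (z + dl)) ->
  is_derive z 1 (fun z : R => g (z + dl)) (g1 (z + dl)).
Proof.
move=> D; rewrite -[X in is_derive _ _ _ X]mulr1.
apply: (@is_derive_compf R g (fun z => z + dl) z _ _ D).
apply: (is_derive_eq (is_derive_addf (is_derive_id z 1) (is_derive_cst dl z 1))).
by rewrite addr0.
Qed.

(** * Shifted supersolutions, and existence below [L] *)

Let Ush (dl z : R) : R := W (z + dl) - W (Z0 + dl).

Let Ush_d (dl z : R) : 0 < z + dl -> is_derive z 1 (Ush dl) (W1 (z + dl)).
Proof.
move=> zd; rewrite -[X in is_derive _ _ _ X]subr0.
exact: (is_derive_subf (shift_d (W_d zd)) (is_derive_cst _ _ _)).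
Qed.

Let W1_le0 (z : R) : W1 z <= 0.
Proof. by rewrite /W1 mulNr oppr_le0 mulr_ge0 ?powR_ge0 // ltW. Qed.

Let Ush_ge0 (dl z : R) : - dl < z <= Z0 -> 0 <= Ush dl z.
Proof.
move=> zI.
apply: (@derive_le0_ge0 R z Z0 (Ush dl) (fun z => W1 (z + dl))).
- by move=> t tI; apply: Ush_d; lra.
- by move=> t tI; exact: W1_le0.
- by rewrite /Ush subrr.
- by case/andP: zI => _ ->; rewrite lexx.
Qed.

Let UE : U = Ush 0.
Proof. by apply/funext => z; rewrite /Ush !addr0. Qed.

Let U_ge0 (z : R) : 0 < z <= Z0 -> 0 <= U z.
Proof. by move=> zI; rewrite UE Ush_ge0 // oppr0. Qed.

Let Ush_le (dl z : R) : 0 < dl -> 0 < z <= Z0 -> Ush dl z <= U z.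
Proof.
move=> dl0 zI; rewrite -subr_ge0.
apply: (@derive_le0_ge0 R z Z0 (fun z => U z - Ush dl z)
  (fun z => W1 z - W1 (z + dl))).
- move=> t tI; have t0 : 0 < t by lra.
  have D1 : is_derive t 1 U (W1 t).
    rewrite -[X in is_derive _ _ _ X]subr0.
    exact: (is_derive_subf (W_d t0) (is_derive_cst _ _ _)).
  by apply: (is_derive_subf D1); apply: Ush_d; rewrite addr_gt0.
- move=> t tI; rewrite /W1 !mulNr opprK addrC subr_le0 ler_pM2l //.
  by apply: powR_le0_anti; [have := al_ge0; lra|lra|rewrite lerDl ltW].
- by rewrite /U /Ush !subrr.
- by case/andP: zI => _ ->; rewrite lexx.
Qed.

(** The left side tends to [l] as [dl] tends to 0. Its last factor pays for replacing 1 + K * (z +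
    dl) by 1 + K * z, which it does as soon as K * z >= - 1 / 2. *)
Let near0_choice l : 0 < l < L -> exists2 dl : R, 0 < dl &
  l * (1 + dl / Z0) `^ (al + 1) * (1 + 2 * K * dl) <= L.
Proof.
move=> /andP[l0 lL].
pose F (dl : R) := l * (1 + dl / Z0) `^ (al + 1) * (1 + 2 * K * dl).
have Fc : {for 0, continuous F}.
  apply: cont_mulf; last first.
    exact: (cont_addf (cont_cst _ _) (cont_mulf (cont_cst _ _) (cont_id _))).
  apply: (cont_mulf (cont_cst _ _)).
  apply: (@cont_compf R R (fun z => z `^ (al + 1)) (fun dl => 1 + dl / Z0)).
    exact: (cont_addf (cont_cst _ _) (cont_mulf (cont_id _) (cont_cst _ _))).
  by apply: powR_cont; rewrite mul0r addr0.
have F0 : F 0 = l by rewrite /F mul0r !addr0 mulr0 addr0 powR1 !mulr1.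
have : \forall dl \near (0 : R), F dl < L.
  by apply: (Fc [set y | y < L]); rewrite F0; exact: lt_nbhsl.
move=> [r /= r0 Hr]; exists (r / 2); first by rewrite divr_gt0.
apply/ltW; apply: Hr; rewrite /ball_ /= sub0r normrN gtr0_norm ?divr_gt0 //.
by rewrite ltr_pdivrMr // mulr2n mulrDr mulr1 ltrDl.
Qed.

(** The coefficients of the operator are taken at [z], the powers at [z + dl]. Were z / (z + dl)
    equal to 1, the right side would be (z + dl)^(-al - 1) * L * (1 + K * z); the difference has the
    good sign because 1 + z >= 0. Slightly negative [z] are allowed since they occur as [sh2 t] for
    t < 0. *)
Let shift_super l (dl z : R) : 0 < l -> 0 < dl ->
  l * (1 + dl / Z0) `^ (al + 1) * (1 + 2 * K * dl) <= L ->
  - dl < z <= Z0 -> - 1 <= z -> - (1 / 2) <= K * z ->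
  l * f (Ush dl z) <= - (4 * z * (1 + z) * W2 (z + dl)
    + (2 * n%:R * (1 + z) + 2 * z) * W1 (z + dl)).
Proof.
move=> l0 dl0 HL zI z1 Kz; have zd : 0 < z + dl by lra.
have Hf := f_shift dl0 zI.
set P := (z + dl) `^ (- al - 1) in Hf *.
have P0 : 0 < P by rewrite powR_gt0.
have -> : W2 (z + dl) = A * (al + 1) * (P / (z + dl)).
  by rewrite /W2 /P -powR_pred // (_ : - al - 1 - 1 = - al - 2) //; ring.
rewrite /W1 -/P; set th := (1 + dl / Z0) `^ (al + 1) in Hf HL *.
have th0 : 0 < th by rewrite powR_gt0 // ltr_wpDr // ltW // divr_gt0.
have q1 : z / (z + dl) <= 1 by rewrite ler_pdivrMr // mul1r lerDl ltW.
have -> : 4 * z * (1 + z) * (A * (al + 1) * (P / (z + dl))) =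
  P * (4 * (1 + z) * A * (al + 1)) * (z / (z + dl)) by field; rewrite gt_eqF.
have nE : n%:R = N + 2 :> R by rewrite /N subrK.
have a0 : 0 <= 4 * (1 + z) * A * (al + 1).
  have z1' : 0 <= 1 + z by lra.
  have al1 : 0 <= al + 1 by rewrite addr_ge0.
  by rewrite !mulr_ge0 // ltW.
apply: (@le_trans _ _ (P * (L * (1 + K * z)))).
  apply: (@le_trans _ _ (l * (th * (P * (1 + K * (z + dl)))))).
    by rewrite ler_pM2l.
  rewrite (_ : l * _ = P * (l * th * (1 + K * (z + dl)))); last by ring.
  rewrite ler_pM2l //.
  apply: (@le_trans _ _ (l * th * (1 + 2 * K * dl) * (1 + K * z))).
    rewrite -[leRHS]mulrA ler_pM2l ?mulr_gt0 //.
    have : 0 <= K * dl by rewrite mulr_ge0 ?ltW.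
    nra.
  by rewrite ler_wpM2r //; lra.
rewrite -subr_ge0 nE.
have -> : - (P * (4 * (1 + z) * A * (al + 1)) * (z / (z + dl)) +
    (2 * (N + 2) * (1 + z) + 2 * z) * (- A * P)) - P * (L * (1 + K * z)) =
  P * (4 * (1 + z) * A * (al + 1)) * (1 - z / (z + dl)) +
  P * (2 * A * (N - 2 * al) - L + z * (2 * A * (N + 1 - 2 * al) - L * K)) by ring.
rewrite -LK -/L !subrr mulr0 addr0 mulr0 addr0.
by rewrite mulr_ge0 ?subr_ge0 // mulr_ge0 // ltW.
Qed.

Let shift_exists l : 0 < l < L -> exists dl e : R,
  [/\ 0 < dl, 0 < e, e < 1, forall t, - (2 * e) < t < 1 -> 0 < sh2 t + dl &
   forall t, - e <= t <= T -> l * f (Ush dl (sh2 t)) <=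
    - (4 * sh2 t * (1 + sh2 t) * W2 (sh2 t + dl)
    + (2 * n%:R * (1 + sh2 t) + 2 * sh2 t) * W1 (sh2 t + dl))].
Proof.
move=> lL; have [dl dl0 HL] := near0_choice lL.
(* The three bounds give z + dl > 0, z >= - 1 and K * z >= - 1 / 2 for z >= - m / 2. By [sh2_ge], t
   >= - m / 8 suffices for that; on the open interval starting at - m / 4 one still has z > - m >= -
   dl. *)
pose m := Num.min (Num.min dl 1) K^-1.
have m0 : 0 < m by rewrite !lt_min dl0 ltr01 invr_gt0.
have [m1 m2] : m <= dl /\ m <= 1 by rewrite !ge_min !lexx /= ?orbT.
have m3 : K * m <= 1.
  by rewrite mulrC -ler_pdivlMr // mul1r ge_min lexx orbT.
have shp t : - (m / 4) < t < 1 -> - m < sh2 t.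
  move=> tI; have [t0|t0] := leP t 0.
    by apply: lt_le_trans (sh2_ge t0); lra.
  by apply: (@lt_trans _ _ 0); [lra|apply: sh2_gt0; lra].
exists dl, (m / 8); split => //; [by rewrite divr_gt0|lra| |].
  move=> t tI; have : - m < sh2 t by (apply: shp; lra).
  lra.
move=> t tI; have /andP[T0 T1] := T_bounds.
have z1 : - (m / 2) <= sh2 t.
  have [t0|t0] := leP t 0; first by apply: le_trans (sh2_ge t0); lra.
  by apply: (@le_trans _ _ 0); [lra|apply/ltW/sh2_gt0; lra].
apply: shift_super => //; first by case/andP: lL.
- have z2 : sh2 t <= Z0 by rewrite -sh2_T; apply: sh2_le => //; lra.
  by rewrite z2 andbT; lra.
- lra.
- by have := K_gt0 => K0; nra.
Qed.

Lemma exists_classical_sol l : 0 < l < L ->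
  exists u : 'rV[R]_n -> R, classical_sol rho l f u.
Proof.
move=> lL; have [dl [e [dl0 e0 e1 Hpos Hsup]]] := shift_exists lL.
have /andP[l0 _] := lL; have /andP[T0 T1] := T_bounds.
have TI t : - e <= t <= T -> - (2 * e) < t < 1.
  by move=> /andP[et /le_lt_trans ->] //; rewrite andbT; lra.
(* [f] is controlled on nonnegative arguments only, while [radial_solution] asks for a source
   defined on the whole line. The solution is positive in the ball, so the truncation disappears. *)
pose F s := l * f (Num.max 0 s); pose F' s := l * f' s.
have maxr0 (s : R) : 0 < s -> Num.max 0 s = s by move=> s0; apply/max_r/ltW.
have D0 t (tI : - (2 * e) < t < 1) := Ush_d (Hpos t tI).
have D1 t (tI : - (2 * e) < t < 1) := shift_d (W1_d (Hpos t tI)).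
have D2 t (tI : - (2 * e) < t < 1) : {for sh2 t, continuous (fun z : R => W2 (z + dl))}.
  apply: (@cont_compf R R W2 (fun z => z + dl)).
    exact: (cont_addf (cont_id _) (cont_cst _ _)).
  exact/W2_cont/Hpos.
have d1E : n.-1.+1 = n by rewrite prednK // (leq_trans _ n3).
have d2E : n.-1.-1%:R = N.
  by rewrite -!subn1 -subnDA natrB // ltnW.
have [|||||||||||||||||U0 [U1 [U2 [Ud U2c Uc Upos UT]]]] := @radial_solution R n.-1 e T
  (- (2 * e)) 1 F F' (fun t => Ush dl (sh2 t))
  (fun t => W1 (sh2 t + dl) * sh2_1 t)
  (fun t => W1 (sh2 t + dl) * sh2_2 t + sh2_1 t * (W2 (sh2 t + dl) * sh2_1 t)) => //.
- by rewrite -ltnS d1E ltnW.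
- lra.
- move=> s; apply: (cont_mulf (cont_cst _ _)).
  apply: (@cont_compf R R f (fun s => Num.max 0 s)).
    by apply: (@continuous_max _ _ (fun=> 0) id); [exact: cvg_cst|exact: cvg_id].
  by apply: f_cont; rewrite le_max lexx.
- move=> s t st; rewrite ler_pM2l //; apply: f_homo; first by rewrite le_max lexx.
  by rewrite ge_max !le_max lexx /= st orbT.
- by move=> s; rewrite mulr_gt0 // f_gt0 // le_max lexx.
- move=> s s0; apply: (@near_eq_is_derive _ _ _ (fun s => l * f s)).
    by near=> r; rewrite /F maxr0 //; near: r; exact: lt_nbhsr.
  exact: (is_derive_scalef l (f_d s0)).
- by move=> s s0; exact: (cont_mulf (cont_cst _ _) (f'_cont s0)).
- exact: (@comp_sh2_d R (- (2 * e)) 1 (Ush dl) (fun z => W1 (z + dl)) (lexx 1) D0).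
- exact: (@comp_sh2_1_d R (- (2 * e)) 1 (fun z => W1 (z + dl))
    (fun z => W2 (z + dl)) (lexx 1) D1).
- exact: (@comp_sh2_2_cont R (- (2 * e)) 1 (fun z => W1 (z + dl))
    (fun z => W2 (z + dl)) (lexx 1) D1 D2).
- move=> t tI; rewrite d1E d2E (@comp_sh2_ode R (- (2 * e)) 1
    (fun z => W1 (z + dl)) (fun z => W2 (z + dl))) //; last exact: TI.
  rewrite /F max_r; last first.
    apply: Ush_ge0; have := Hpos t; rewrite -sh2_T.
    have -> : sh2 t <= sh2 T by case/andP: tI => ? ?; apply: sh2_le => //; lra.
    by move=> /(_ (TI t tI)) H; rewrite andbT; lra.
  exact: Hsup.
- by rewrite sh2_T /Ush subrr.
have ball (x : 'rV[R]_n) : hball rho x -> - e < sqn x < T.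
  by move=> /(hballE _ rho_gt0) ->; rewrite andbT (lt_le_trans _ (sqn_ge0 x)) // oppr_lt0.
have d0 (t : R) (tI : - e < t < T) := (Ud t tI).1.
have d1 (t : R) (tI : - e < t < T) := (Ud t tI).2.
exists (fun x => U0 (sqn x)); split.
- exact: (C2_radial d0 d1).
- apply: continuous_in_subspaceT => x; rewrite inE => /(hcballE _ rho_gt0) xT.
  apply: (@cont_compf R _ U0 sqn); first exact: sqn_cont.
  by apply: Uc; rewrite sqn_ge0.
- move=> x /ball xb; rewrite (LapB_radial d0 d1 xb).
  have [Ux] := Upos _ xb; rewrite /F maxr0 // => ->.
  by rewrite d1E d2E.
- by move=> x /ball /Upos[].
- by move=> x /(hsphereE _ rho_gt0) ->.
Unshelve. all: end_near. Qed.

Lemma minimal_sol_le l (u : 'rV[R]_n -> R) x : 0 < l < L -> minimal_sol rho l f u ->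
  hball rho x -> x != 0 -> u x <= U (sh2 (sqn x)).
Proof.
move=> lL [_ umin] xb x0; have [dl [e [dl0 e0 e1 Hpos Hsup]]] := shift_exists lL.
have /andP[T0 T1] := T_bounds.
have D0 t (tI : - (2 * e) < t < 1) := Ush_d (Hpos t tI).
have D1 t (tI : - (2 * e) < t < 1) := shift_d (W1_d (Hpos t tI)).
have D2 t (tI : - (2 * e) < t < 1) : {for sh2 t, continuous (fun z : R => W2 (z + dl))}.
  apply: (@cont_compf R R W2 (fun z => z + dl)).
    exact: (cont_addf (cont_id _) (cont_cst _ _)).
  exact/W2_cont/Hpos.
have ball (y : 'rV[R]_n) : hcball rho y -> - (2 * e) < sqn y < 1.
  by move=> /(hcballE _ rho_gt0) H; have := sqn_ge0 y; rewrite -/T in H; lra.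
have bcb (y : 'rV[R]_n) : hball rho y -> hcball rho y by case=> y1 /ltW.
have ge0 (y : 'rV[R]_n) : hcball rho y -> 0 <= Ush dl (sh2 (sqn y)).
  move=> yb; apply: Ush_ge0; have := Hpos _ (ball _ yb).
  have -> : sh2 (sqn y) <= Z0.
    rewrite -sh2_T; move/(hcballE _ rho_gt0): yb => yT.
    by apply: sh2_le => //; have := sqn_ge0 y; lra.
  by rewrite andbT; lra.
have x1 : 0 < sh2 (sqn x) <= Z0.
  move/(hballE _ rho_gt0): xb => xT; have := sqn_gt0 x; rewrite x0 -/T in xT * => s0.
  rewrite sh2_gt0 /= -?sh2_T; last by rewrite s0; lra.
  by apply: sh2_le; rewrite ?(ltW xT) //; lra.
apply: le_trans (Ush_le dl0 x1).
apply: (umin (fun y => Ush dl (sh2 (sqn y)))) => //; split.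
- by apply: (@C2_sh2 R n (- (2 * e)) 1 (Ush dl) (fun z => W1 (z + dl))
    (fun z => W2 (z + dl)) (lexx 1) D0 D1 D2) => // y /bcb /ball.
- apply: continuous_in_subspaceT => y; rewrite inE => /ball yb.
  apply: (@cont_compf R _ (fun t => Ush dl (sh2 t)) sqn); first exact: sqn_cont.
  have yD := @comp_sh2_d R (- (2 * e)) 1 (Ush dl) (fun z => W1 (z + dl))
    (lexx 1) D0 _ yb.
  exact: (is_derive_cont yD).
- move=> y yb; rewrite (@LapB_sh2 R n (- (2 * e)) 1 (Ush dl)
    (fun z => W1 (z + dl)) (fun z => W2 (z + dl)) (lexx 1) D0 D1 y (ball _ (bcb _ yb))) //.
  apply: Hsup; move/(hballE _ rho_gt0): yb => /ltW ->; rewrite andbT.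
  by have := sqn_ge0 y; lra.
- by move=> y /bcb /ge0.
- by move=> y [y1 yr]; apply: ge0; split => //; rewrite yr.
Qed.

(** * Lower bound for classical solutions by the Hardy weight *)

Let Dc : R := (1 + K * Z0) * Z0 `^ (gam - al - 1) / c.

Let Dc_ge0 : 0 <= Dc.
Proof.
by rewrite divr_ge0 ?mulr_ge0 ?powR_ge0 ?(ltW c_gt0) // addr_ge0 // mulr_ge0 // ltW.
Qed.

(** The quotient of the two powers is z^(gam - al - 1), nondecreasing by [al_gam], so its bound at
    [Z0] fixes [Dc]. *)
Let fU_le (z : R) : 0 < z <= Z0 ->
  z `^ (- al - 1) * (1 + K * z) <= c * Dc * z `^ (- gam).
Proof.
move=> /andP[z0 zZ].
have -> : z `^ (- al - 1) = z `^ (gam - al - 1) * z `^ (- gam).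
  rewrite -powRD; first by congr powR; ring.
  by apply/implyP => _; rewrite gt_eqF.
have -> : c * Dc = (1 + K * Z0) * Z0 `^ (gam - al - 1).
  by rewrite /Dc; field; rewrite gt_eqF.
rewrite mulrAC ler_wpM2r ?powR_ge0 // mulrC.
apply: ler_pM; rewrite ?powR_ge0 //.
- by rewrite addr_ge0 // mulr_ge0 // ltW.
- by rewrite lerD2l ler_pM2l.
- apply: ge0_ler_powR; rewrite ?nnegrE ?(ltW z0) ?(ltW Z0_gt0) //.
  by have := al_gam; lra.
Qed.

(** [M] is the maximum of the quotient and [s] the value of the solution where it is attained; the
    last premise is Delta (U - M * psi) <= Delta u there. Since - Delta psi = psi / z * (N^2 / 4 + z
    * N * (N + 2) / 4), [V_hardy] lets the linearised term L * V * M * psi be subtracted with c * M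
    * psi to spare, and only max 0 (L - l) * f (U) is left to bound it. *)
Let max_estimate (l z s M : R) : 0 < z <= Z0 -> 0 < s -> 0 < M ->
  U z - s = M * z `^ (- gam) ->
  4 * z * (1 + z) * (W2 z - M * (gam * (gam + 1) * z `^ (- gam - 2)))
  + (2 * n%:R * (1 + z) + 2 * z) * (W1 z - M * (- gam * z `^ (- gam - 1)))
    <= - (l * f s) ->
  M <= Dc * Num.max 0 (L - l).
Proof.
move=> zI s0 M0 phiE; have [z0 zZ] := andP zI.
have z_neq0 : z != 0 by rewrite gt_eqF.
have psi0 : 0 < z `^ (- gam) by rewrite powR_gt0.
have E1 : z `^ (- gam - 1) = z `^ (- gam) / z by rewrite powR_pred.
have E2 : z `^ (- gam - 2) = z `^ (- gam) / z / z.
  by rewrite (_ : - gam - 2 = - gam - 1 - 1) ?powR_pred //; ring.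
have E3 : W2 z = A * (al + 1) * (z `^ (- al - 1) / z).
  by rewrite /W2 (_ : - al - 2 = - al - 1 - 1) ?powR_pred //; ring.
have E4 := fU zI; have E5 := fU_le zI; have E6 := V_hardy zI.
have E7 := f_convex zI (ltW s0).
have fs_le : f s <= f (U z).
  by apply: f_homo; [exact: ltW|rewrite -subr_ge0 phiE mulr_ge0 ?ltW].
have fs0 := f_gt0 (ltW s0).
rewrite E1 E2 E3 /W1 => H.
set P := z `^ (- al - 1) in E4 E5 H; set psi := z `^ (- gam) in E5 phiE psi0 H.
have nE : n%:R = N + 2 :> R by rewrite /N subrK.
have gE : gam = N / 4 by [].
have {}H : M * psi / z * (N ^+ 2 / 4 + z * (N * (N + 2) / 4)) <=
    L * f (U z) - l * f s.
  rewrite -subr_ge0 in H.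
  rewrite -subr_ge0; move: H; congr (0 <= _).
  rewrite E4 nE gE.
  have -> : L * (P * (1 + K * z)) = P * (L + z * (L * K)) by ring.
  by rewrite LK /L; field.
have Vphi : L * (V z * (M * psi)) <= M * psi / z * (N ^+ 2 / 4 + z * (N * (N + 2) / 4 - c)).
  have -> : L * (V z * (M * psi)) = M * psi / z * (L * V z * z) by field.
  by rewrite ler_pM2l // divr_gt0 // mulr_gt0.
have m0 : 0 <= Num.max 0 (L - l) by rewrite le_max lexx.
have key : L * f (U z) - l * f s <= L * (V z * (M * psi)) + Num.max 0 (L - l) * f (U z).
  rewrite -phiE; have : L * (f (U z) - f s) <= L * (V z * (U z - s)) by rewrite ler_pM2l.
  (* What remains after the convexity inequality is (L - l) * f s: at most (L - l) * f (U z) in the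
     first case, negative in the second. *)
  have [lL|lL] := leP l L.
    rewrite max_r ?subr_ge0 //; have : (L - l) * f s <= (L - l) * f (U z).
      by rewrite ler_wpM2l // subr_ge0.
    lra.
  rewrite max_l ?subr_le0 ?(ltW lL) // mul0r.
  have : L * f s <= l * f s by rewrite ler_pM2r // ltW.
  lra.
have : M * psi * c <= Num.max 0 (L - l) * (c * Dc * psi).
  have -> : M * psi * c = M * psi / z * (N ^+ 2 / 4 + z * (N * (N + 2) / 4))
    - M * psi / z * (N ^+ 2 / 4 + z * (N * (N + 2) / 4 - c)) by field.
  have : Num.max 0 (L - l) * f (U z) <= Num.max 0 (L - l) * (c * Dc * psi).
    by rewrite ler_wpM2l // E4.
  lra.
rewrite (_ : Num.max 0 (L - l) * (c * Dc * psi) = Dc * Num.max 0 (L - l) * psi * c);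
  last by ring.
by rewrite ler_pM2r // ler_pM2r.
Qed.

Let psi_d (z : R) : 0 < z -> is_derive z 1 (fun z : R => z `^ (- gam))
  (- gam * z `^ (- gam - 1)).
Proof. by move=> z0; exact: is_derive1_powR. Qed.

Let psi1_d (z : R) : 0 < z ->
  is_derive z 1 (fun z : R => - gam * z `^ (- gam - 1))
    (gam * (gam + 1) * z `^ (- gam - 2)).
Proof.
move=> z0; have D := is_derive_scalef (- gam) (is_derive1_powR (- gam - 1) z0).
apply: (is_derive_eq D); rewrite (_ : - gam - 1 - 1 = - gam - 2); ring.
Qed.

Let U_d (z : R) : 0 < z -> is_derive z 1 U (W1 z).
Proof.
move=> z0; rewrite -[X in is_derive _ _ _ X]subr0.
exact: (is_derive_subf (W_d z0) (is_derive_cst _ _ _)).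
Qed.

Let U_small (q0 : R) : 0 < q0 -> exists2 z1, 0 < z1 &
  forall z, 0 < z < z1 -> z <= Z0 -> U z * z `^ gam < q0.
Proof.
move=> q0_gt0; have e0 : 0 < gam - kap by rewrite subr_gt0.
have := @powR_cvg0 R (gam - kap) e0; move/cvgrPdist_lt.
have C0 : 0 < `|Cg| + 1 by rewrite ltr_wpDl.
move=> /(_ (q0 / (`|Cg| + 1))); rewrite divr_gt0 // => /(_ isT) [r /= r0 Hr].
exists r => // z /andP[z0 zr] zZ.
have := Hr z; rewrite /ball_ /= sub0r normrN gtr0_norm // => /(_ zr z0).
rewrite sub0r normrN ger0_norm ?powR_ge0 // ltr_pdivlMr // => H.
apply: le_lt_trans H.
apply: (@le_trans _ _ (Cg * z `^ (- kap) * z `^ gam)).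
  by rewrite ler_wpM2r ?powR_ge0 // U_growth // z0.
have -> : z `^ (gam - kap) = z `^ (- kap) * z `^ gam.
  rewrite -powRD; first by congr powR; ring.
  by apply/implyP => _; rewrite gt_eqF.
rewrite -mulrA mulrC ler_wpM2l ?mulr_ge0 ?powR_ge0 //.
by rewrite (le_trans (ler_norm _)) // lerDl.
Qed.

Let sh2_small (z1 : R) : 0 < z1 -> exists2 t1, 0 < t1 &
  forall t, 0 < t <= t1 -> sh2 t < z1.
Proof.
move=> z1_gt0; have c0 : {for (0 : R), continuous (@sh2 R)}.
  by have /is_derive_cont := @sh2_d R 0 ltac:(by rewrite eq_sym oner_eq0).
have : \forall t \near (0 : R), sh2 t < z1.
  by apply: (c0 [set y | y < z1]); rewrite sh2_0; exact: lt_nbhsl.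
move=> [r /= r0 Hr]; exists (r / 2); first by rewrite divr_gt0.
move=> t /andP[t0 tr]; apply: Hr; rewrite /ball_ /= sub0r normrN gtr0_norm //.
by apply: le_lt_trans tr _; rewrite ltr_pdivrMr // mulr2n mulrDr mulr1 ltrDl.
Qed.

Lemma annulus_compact (a b : R) : compact [set x : 'rV[R]_n | a <= sqn x <= b].
Proof.
apply: bounded_closed_compact.
  exists (1 + `|b|); split; first exact: num_real.
  move=> M bM x /= /andP[_ xb].
  have M0 : 0 <= M by rewrite (le_trans _ (ltW bM)) // addr_ge0.
  rewrite /Num.norm /= mx_normrE; apply/bigmax_leP; split=> // -[i j] _ /=.
  rewrite (ord1 i) -(@ler_pXn2r _ 2) ?nnegrE // -normrX ger0_norm ?sqr_ge0 //.
  apply: (@le_trans _ _ (sqn x)).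
    by rewrite /sqn (bigD1 j) //= lerDl sumr_ge0 // => k _; exact: sqr_ge0.
  apply: le_trans xb _; apply: le_trans (ler_norm b) _.
  have : `|b| <= M by apply: le_trans (ltW bM); rewrite lerDr.
  have : 1 <= M by apply: le_trans (ltW bM); rewrite lerDl.
  nra.
have -> : [set x : 'rV[R]_n | a <= sqn x <= b] = sqn @^-1` `[a, b]%classic.
  by apply/seteqP; split=> x /=; rewrite in_itv.
by apply: closed_comp; [move=> x _; exact: sqn_cont|exact: itv_closed].
Qed.

Lemma classical_sol_lower_bound l (u : 'rV[R]_n -> R) x : classical_sol rho l f u ->
  hball rho x -> x != 0 -> U (sh2 (sqn x)) - u x <=
    Dc * Num.max 0 (L - l) * sh2 (sqn x) `^ (- gam).
Proof.
move=> [uC2 uc upde upos u0] xb x0; rewrite leNgt; apply/negP => Hx.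
have /andP[T0 T1] := T_bounds.
set D := Dc * Num.max 0 (L - l) in Hx.
have D_ge0 : 0 <= D by rewrite mulr_ge0 // le_max lexx.
have zI (t : R) : 0 < t <= T -> 0 < sh2 t <= Z0.
  move=> /andP[t0 tT]; rewrite sh2_gt0 ?t0 ?(le_lt_trans tT) //= -sh2_T.
  by apply: sh2_le => //; lra.
have xT : 0 < sqn x < T by rewrite sqn_gt0 x0; apply/(hballE _ rho_gt0).
have xT' : 0 < sqn x <= T by case/andP: xT => -> /ltW.
pose q (y : 'rV[R]_n) : R := (U (sh2 (sqn y)) - u y) * sh2 (sqn y) `^ gam.
have qE (y : 'rV[R]_n) : 0 < sqn y <= T ->
    U (sh2 (sqn y)) - u y = q y * sh2 (sqn y) `^ (- gam).
  move=> /zI /andP[z0 _]; rewrite /q -mulrA -powRD ?subrr ?powRr0 ?mulr1 //.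
  by apply/implyP => _; rewrite gt_eqF.
have qx : D < q x.
  by move: Hx; rewrite qE // ltr_pM2r // powR_gt0; have /andP[] := zI _ xT'.
have qx0 := le_lt_trans D_ge0 qx.
have [z1 z1_gt0 Hz1] := U_small qx0.
have [t2 t2_gt0 Ht2] := sh2_small z1_gt0.
(* The inner radius of an annulus that contains [x] and on whose inner sphere [q] is below [q x].
   The annulus is compact and avoids the origin, so the maximum exists and is interior. *)
pose t1 := Num.min t2 (sqn x).
have [t12 t1x] : t1 <= t2 /\ t1 <= sqn x by rewrite !ge_min !lexx orbT.
have t1_gt0 : 0 < t1 by rewrite lt_min t2_gt0; case/andP: xT.
have qsmall (y : 'rV[R]_n) : sqn y = t1 -> q y < q x.
  move=> yt; have yT : 0 < sqn y <= T.
    by rewrite yt t1_gt0 (le_trans t1x) //; case/andP: xT'.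
  have yb : hball rho y.
    by apply/(hballE _ rho_gt0); rewrite yt (le_lt_trans t1x) //; case/andP: xT.
  have /andP[z0 zZ] := zI _ yT; have /andP[s0 sT] := yT.
  have zz : sh2 (sqn y) < z1 by apply: Ht2; rewrite s0 yt.
  apply: le_lt_trans (Hz1 _ _ zZ); last by rewrite z0.
  by rewrite /q ler_wpM2r ?powR_ge0 // gerBl ltW // upos.
pose Kset := [set y : 'rV[R]_n | t1 <= sqn y <= T].
have Kpos (y : 'rV[R]_n) : Kset y -> 0 < sqn y <= T.
  by move=> /andP[ty ->]; rewrite (lt_le_trans t1_gt0 ty).
have qc : {within Kset, continuous q}.
  have uK : {within Kset, continuous u}.
    by apply: continuous_subspaceW uc => y /Kpos /andP[_ yT]; exact/(hcballE _ rho_gt0).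
  have zc (y : 'rV[R]_n) : Kset y -> {for y, continuous (fun y => sh2 (sqn y) : R)}.
    move=> /Kpos /andP[_ yT]; apply: (@cont_compf R _ (@sh2 R) sqn).
      exact: sqn_cont.
    by have /is_derive_cont := @sh2_d R (sqn y) ltac:(by rewrite lt_eqF // (le_lt_trans yT)).
  have Uc : {within Kset, continuous (fun y => U (sh2 (sqn y)))}.
    apply: continuous_in_subspaceT => y; rewrite inE => yK.
    have /andP[z0 _] := zI _ (Kpos _ yK).
    exact: (cont_compf (zc _ yK) (is_derive_cont (U_d z0))).
  have pc : {within Kset, continuous (fun y => sh2 (sqn y) `^ gam)}.
    apply: continuous_in_subspaceT => y; rewrite inE => yK.
    have /andP[z0 _] := zI _ (Kpos _ yK).
    exact: (cont_compf (zc _ yK) (powR_cont (r := gam) z0)).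
  move=> y; apply: cvgM; last exact: pc.
  by apply: cvgB; [exact: Uc|exact: uK].
have xK : Kset x by rewrite /Kset /= t1x; case/andP: xT'.
have [y yK ymax] := @EVT_max_rV R n q Kset (ex_intro _ x xK) (@annulus_compact t1 T) qc.
move: yK; rewrite inE => yK; have yT := Kpos _ yK.
have qxy : q x <= q y by apply: ymax; rewrite inE.
have M0 : 0 < q y by exact: lt_le_trans qx0 qxy.
have y1 : t1 < sqn y.
  have /andP[] := yK; rewrite le_eqVlt => /predU1P[/esym /qsmall|//].
  by rewrite ltNge qxy.
have y2 : sqn y < T.
  have /andP[_] := yK; rewrite le_eqVlt => /predU1P[yT'|//].
  move: M0; rewrite /q yT' sh2_T u0; last exact/(hsphereE _ rho_gt0).
  by rewrite /U subrr subr0 mul0r !ltxx.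
have yb : hball rho y by apply/(hballE _ rho_gt0).
(* This touches [u] from below at [y]: H - u is [psi] times q - q y, which is nonpositive on the
   annulus and vanishes at [y]. *)
pose H (z : R) := U z - q y * z `^ (- gam).
pose H1 (z : R) := W1 z - q y * (- gam * z `^ (- gam - 1)).
pose H2 (z : R) := W2 z - q y * (gam * (gam + 1) * z `^ (- gam - 2)).
have tz (t : R) : t1 < t < T -> 0 < sh2 t.
  by move=> /andP[t1t tT]; apply: sh2_gt0; rewrite (lt_trans t1_gt0) // (lt_trans tT).
have D0 (t : R) : t1 < t < T -> is_derive (sh2 t) 1 H (H1 (sh2 t)).
  move=> /tz z0.
  exact: (is_derive_subf (U_d z0) (is_derive_scalef (q y) (psi_d z0))).
have D1 (t : R) : t1 < t < T -> is_derive (sh2 t) 1 H1 (H2 (sh2 t)).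
  move=> /tz z0.
  exact: (is_derive_subf (W1_d z0) (is_derive_scalef (q y) (psi1_d z0))).
have D2 (t : R) : t1 < t < T -> {for sh2 t, continuous H2}.
  move=> /tz z0; apply: (cont_addf (W2_cont z0)); apply: cont_oppf.
  apply: (cont_mulf (cont_cst _ _)); apply: (cont_mulf (cont_cst _ _)).
  exact: powR_cont.
pose B := [set y : 'rV[R]_n | t1 < sqn y < T].
have nearB : \forall r \near y, B r by apply: near_sqn_oo; rewrite y1 y2.
have BK r : B r -> Kset r.
  by move=> /andP[/ltW r1 /ltW r2]; rewrite /Kset /= r1.
have HC2 : C2_on B (fun r => H (sh2 (sqn r))).
  by apply: (@C2_sh2 R n t1 T H H1 H2 (ltW T1) D0 D1 D2).
have uB : C2_on B u.
  by move=> r /andP[_ rT]; apply: uC2; exact/(hballE _ rho_gt0).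
have Hmax : LapB (fun r => H (sh2 (sqn r))) y <= LapB u y.
  apply: (LapB_local_max _ HC2 uB nearB); first by case: yb.
  apply: filterS nearB => r rB; have rK := BK _ rB.
  have qr : q r <= q y by apply: ymax; rewrite inE.
  rewrite /H addrAC qE ?(Kpos _ rK) // [leRHS]addrAC qE // subrr subr_le0.
  by rewrite ler_wpM2r ?powR_ge0.
rewrite (@LapB_sh2 R n t1 T H H1 H2 (ltW T1) D0 D1) ?y1 ?y2 // in Hmax.
rewrite -[X in _ <= X]opprK upde // in Hmax.
have := @max_estimate l _ (u y) (q y) (zI _ yT) (upos _ yb) M0 (qE _ yT) Hmax.
by rewrite -/D leNgt (lt_le_trans qx).
Qed.

Lemma exists_sqn (t : R) : 0 <= t -> exists x : 'rV[R]_n, sqn x = t.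
Proof.
move=> t0; have n0 : (0 < n)%N by apply: leq_trans n3.
exists (Num.sqrt t *: ebasis R (Ordinal n0) + 0); rewrite sqn_line sqn0 mxE.
by rewrite mulr0 mul0r !addr0 sqr_sqrtr.
Qed.

(** The contradiction is drawn after applying [f]: [fU] gives f (U z) >= z^(-al - 1) >= 1 / z for z
    <= 1, whereas [f] is at most [F] along the solution. The threshold [z1] makes 1 / z exceed
    [F]. *)
Lemma classical_sol_param_le (l : R) (u : 'rV[R]_n -> R) :
  classical_sol rho l f u -> l <= L.
Proof.
move=> uS; have [_ uc _ upos _] := uS; rewrite leNgt; apply/negP => Ll.
have /andP[T0 T1] := T_bounds.
have [|||y _ ymax] := @EVT_max_rV R n u [set x | 0 <= sqn x <= T].
- by exists 0; rewrite /= sqn0 lexx ltW.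
- exact: annulus_compact.
- by apply: continuous_subspaceW uc => x /andP[_ xT]; apply/(hcballE _ rho_gt0).
have fle (t : R) : 0 < t < T -> sh2 t `^ (- al - 1) <= f (Num.max 0 (u y)).
  move=> /andP[t0 tT]; have [x xt] := exists_sqn (ltW t0).
  have xb : hball rho x by apply/(hballE _ rho_gt0); rewrite xt.
  have x0 : x != 0 by rewrite -sqn_gt0 xt.
  have := classical_sol_lower_bound uS xb x0.
  rewrite max_l ?subr_le0 ?(ltW Ll) // mulr0 mul0r subr_le0 xt => Uu.
  have z0 : 0 < sh2 t by rewrite sh2_gt0 // t0 (lt_trans tT).
  have zI : 0 < sh2 t <= Z0 by rewrite z0 -sh2_T sh2_le //; lra.
  have yx : u x <= u y.
    by apply: ymax; rewrite inE /= xt (ltW t0) (ltW tT).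
  apply: (@le_trans _ _ (f (U (sh2 t)))).
    by rewrite fU // ler_peMr ?powR_ge0 // lerDl mulr_ge0 // ltW.
  apply: f_homo; first exact: U_ge0.
  by rewrite le_max (le_trans Uu yx) orbT.
set F := f _ in fle; have F0 : 0 < F by apply: f_gt0; rewrite le_max lexx.
pose z1 := Num.min 1 F^-1.
have z1_gt0 : 0 < z1 by rewrite lt_min ltr01 invr_gt0.
have [t1 t1_gt0 Ht1] := sh2_small z1_gt0.
pose t := Num.min t1 T / 2.
have m0 : 0 < Num.min t1 T by rewrite lt_min t1_gt0.
have [tt1 ttT] : Num.min t1 T <= t1 /\ Num.min t1 T <= T by rewrite !ge_min !lexx orbT.
have tm : t < Num.min t1 T by rewrite ltr_pdivrMr // mulr2n mulrDr mulr1 ltrDl.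
have t0 : 0 < t by rewrite divr_gt0.
have tT : t < T by exact: lt_le_trans tm ttT.
have z0 : 0 < sh2 t by rewrite sh2_gt0 // t0 (lt_trans tT).
have : sh2 t < z1.
  by apply: Ht1; rewrite t0 (le_trans (ltW tm)).
rewrite lt_min => /andP[zl1 zlF].
have : sh2 t `^ (-1) <= F.
  apply: le_trans (fle t _); last by rewrite t0.
  by apply: ger_powR; [rewrite z0 ltW|rewrite gerDr oppr_le0].
rewrite powR_inv1 ?(ltW z0) // leNgt => /negP; apply.
by rewrite -[F]invrK ltf_pV2 ?posrE ?invr_gt0.
Qed.

(** * The extremal parameter and the limit of minimal solutions *)

Lemma lambda_starE : lambda_star n rho f = L.
Proof.
have ubL : ubound [set l : R | 0 < l /\
    exists u : 'rV[R]_n -> R, classical_sol rho l f u] L.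
  by move=> l [_ [u]]; exact: classical_sol_param_le.
have mem (l : R) : 0 < l < L -> [set l : R | 0 < l /\
    exists u : 'rV[R]_n -> R, classical_sol rho l f u] l.
  by move=> /[dup] lL /andP[l0 _]; split=> //; exact: exists_classical_sol.
have half : 0 < L / 2 < L.
  by rewrite divr_gt0 //= ltr_pdivrMr // mulr2n mulrDr mulr1 ltrDl.
apply/eqP; rewrite eq_le; apply/andP; split.
  by apply: ge_sup => //; exists (L / 2); exact: mem.
rewrite leNgt; apply/negP => sL.
set s := lambda_star n rho f in sL.
(* A positive parameter strictly between [s] and [L], whatever the sign of [s]. *)
pose r := (Num.max s 0 + L) / 2.
have m1 : Num.max s 0 < L by rewrite gt_max sL.
have [m2 m3] : s <= Num.max s 0 /\ 0 <= Num.max s 0 by rewrite !le_max !lexx orbT.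
have rL : 0 < r < L by rewrite /r; lra.
have : r <= s by apply: ub_le_sup; [exists L|exact: mem].
rewrite /r; lra.
Qed.

Lemma minimal_sol_cvg (u : R -> 'rV[R]_n -> R) x :
  (forall l, 0 < l < L -> minimal_sol rho l f (u l)) ->
  hball rho x -> x != 0 -> (fun l => u l x) @ L^'- --> U (sh2 (sqn x)).
Proof.
move=> um xb x0; set Ux := U _; set psi := sh2 (sqn x) `^ (- gam).
apply: (@squeeze_cvgr _ _ _ _ (fun l => Ux - Dc * (L - l) * psi) (fun=> Ux)).
- near=> l; have lL : 0 < l < L.
    by apply/andP; split; near: l; [exact: nbhs_left_gt|exact: nbhs_left_lt].
  apply/andP; split; last exact: minimal_sol_le (um _ lL) xb x0.
  have [uS _] := um _ lL; have := classical_sol_lower_bound uS xb x0.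
  rewrite max_r; last by rewrite subr_ge0; case/andP: lL => _ /ltW.
  by rewrite -/Ux -/psi; lra.
- rewrite -[X in _ --> X]subr0 -(mul0r psi) -(mulr0 Dc) -(subrr L).
  apply: cvg_at_left_filter.
  apply: cvgB; first exact: cvg_cst.
  apply: cvgM; last exact: cvg_cst.
  apply: cvgM; first exact: cvg_cst.
  by apply: cvgB; [exact: cvg_cst|exact: cvg_id].
- exact: cvg_cst.
Unshelve. all: end_near. Qed.

Lemma extremal : lambda_star n rho f = L /\
  forall (u : R -> 'rV[R]_n -> R) x,
    (forall l, 0 < l < L -> minimal_sol rho l f (u l)) ->
    hball rho x -> x != 0 ->
    (fun l => u l x) @ L^'- --> W (sh2 (sqn x)) - W Z0.
Proof. by split; [exact: lambda_starE|move=> u x; exact: minimal_sol_cvg]. Qed.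

End Extremal.

(** * The two nonlinearities *)

Section Exponential.
Context {R : realType} {n : nat}.
Variables (rho : R).
Hypotheses (n10 : (10 <= n)%N) (rho_gt0 : 0 < rho).
Let N : R := n%:R - 2.
Let Z0 : R := sinhR rho ^+ 2.
Let K : R := (n%:R - 1) / (n%:R - 2).
Let W (z : R) : R := - ln z.

Let N_ge8 : 8 <= N.
Proof. by rewrite lerBrDr -natrD ler_nat. Qed.

Let N_gt0 : 0 < N.
Proof. by have := N_ge8; lra. Qed.

Let Z0_gt0 : 0 < Z0.
Proof. by rewrite exprn_gt0 // sinhR_gt0. Qed.

Let K_gt0 : 0 < K.
Proof. by rewrite divr_gt0 // subr_gt0 ltr1n (leq_trans _ n10). Qed.

Let expW (z : R) : 0 < z -> expR (W z - W Z0) = Z0 / z.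
Proof.
by move=> z0; rewrite opprK addrC expRD expRN !lnK ?posrE.
Qed.

(** The unreduced constants are those of [extremal] at A = 1 and al = 0, the values for W = - ln. *)
Let exp_data : lambda_star n rho (f_exp n rho) = 2 * 1 * (N - 2 * 0) /\
  forall (u : R -> 'rV[R]_n -> R) x,
  (forall l, 0 < l < 2 * 1 * (N - 2 * 0) -> minimal_sol rho l (f_exp n rho) (u l)) ->
  hball rho x -> x != 0 -> (fun l => u l x) @ (2 * 1 * (N - 2 * 0))^'- -->
    W (sh2 (sqn x)) - W Z0.
Proof.
have n3 : (3 <= n)%N by apply: leq_trans n10.
have c0 : 0 < N * (N + 2) / 4 by rewrite divr_gt0 // mulr_gt0 // addr_gt0.
have L0 : 0 < 2 * 1 * (N - 2 * 0) by rewrite mulr0 subr0 mulr1 mulr_gt0.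
have KE : 2 * 1 * (N - 2 * 0) * K = 2 * 1 * (N + 1 - 2 * 0).
  by rewrite /K -/N; have -> : n%:R - 1 = N + 1 by [rewrite /N; ring]; field; rewrite gt_eqF.
have ag : 0 + 1 <= N / 4 by have := N_ge8; lra.
have kg : 1 < N / 4 by have := N_ge8; lra.
have Wd (z : R) : 0 < z -> is_derive z 1 W (- 1 * z `^ (- 0 - 1)).
  move=> z0; apply: (is_derive_eq (is_derive_oppf (is_derive1_ln z0))).
  by rewrite oppr0 sub0r powR_inv1 ?ltW // mulN1r.
have fE (s : R) : f_exp n rho s = expR s / Z0 + K by [].
have fU (z : R) : 0 < z <= Z0 ->
    f_exp n rho (W z - W Z0) = z `^ (- 0 - 1) * (1 + K * z).
  move=> /andP[z0 _]; rewrite fE expW // oppr0 sub0r powR_inv1 ?ltW //.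
  by field; rewrite !gt_eqF.
have fsh (dl z : R) : 0 < dl -> - dl < z <= Z0 ->
    f_exp n rho (W (z + dl) - W (Z0 + dl)) <=
    (1 + dl / Z0) `^ (0 + 1) * ((z + dl) `^ (- 0 - 1) * (1 + K * (z + dl))).
  move=> dl0 /andP[dz zZ]; have zd : 0 < z + dl by lra.
  have Zd : 0 < Z0 + dl by rewrite addr_gt0.
  have q0 : 0 < dl / Z0 by rewrite divr_gt0.
  have -> : f_exp n rho (W (z + dl) - W (Z0 + dl)) = (Z0 + dl) / (z + dl) / Z0 + K.
    by rewrite fE; congr (_ / _ + _); rewrite opprK addrC expRD expRN !lnK.
  rewrite oppr0 sub0r add0r powRr1 ?powR_inv1 ?(ltW zd) //; last first.
    by rewrite addr_ge0 // ltW.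
  rewrite -subr_ge0.
  have -> : (1 + dl / Z0) * ((z + dl)^-1 * (1 + K * (z + dl))) -
    ((Z0 + dl) / (z + dl) / Z0 + K) = K * (dl / Z0) by field; rewrite !gt_eqF.
  by rewrite mulr_ge0 // ltW.
have fcv (z s : R) : 0 < z <= Z0 -> 0 <= s ->
    f_exp n rho (W z - W Z0) - f_exp n rho s <= z^-1 * (W z - W Z0 - s).
  move=> /andP[z0 _] _; set v := W z - W Z0.
  have -> : z^-1 = expR v / Z0 by rewrite expW //; field; rewrite !gt_eqF.
  have -> : f_exp n rho v - f_exp n rho s = expR v / Z0 * (1 - expR (s - v)).
    rewrite !fE expRD expRN; field.
    by rewrite !gt_eqF ?expR_gt0.
  rewrite ler_pM2l; last by rewrite divr_gt0 // expR_gt0.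
  by have := expR_ge1Dx (s - v); lra.
(* Here L * V * z is the constant 2 * N, so the inequality amounts to N >= 8, that is n >= 10, and
   the whole curvature term can serve as [c]. *)
have hd (z : R) : 0 < z <= Z0 -> 2 * 1 * (N - 2 * 0) * z^-1 * z <=
    N ^+ 2 / 4 + z * (N * (N + 2) / 4 - N * (N + 2) / 4).
  move=> /andP[z0 _]; rewrite subrr !mulr0 addr0 mulfVK ?gt_eqF //.
  by have := N_ge8; nra.
(* The crude bound U <= expR U = Z0 / z is enough: the exponent 1 is below N / 4 >= 2. *)
have gr (z : R) : 0 < z <= Z0 -> W z - W Z0 <= Z0 * z `^ (- 1).
  move=> /andP[z0 _].
  have -> : Z0 * z `^ (- 1) = expR (W z - W Z0) by rewrite expW // powR_inv1 ?ltW.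
  by apply: (le_trans _ (expR_ge1Dx _)); rewrite lerDr.
have fc (s : R) : 0 <= s -> {for s, continuous (f_exp n rho)}.
  move=> _; apply: (cont_addf _ (cont_cst _ _)).
  apply: (cont_mulf _ (cont_cst _ _)); exact: continuous_expR.
have fh (s t : R) : 0 <= s -> s <= t -> f_exp n rho s <= f_exp n rho t.
  by move=> _ st; rewrite !fE lerD2r ler_pM2r ?invr_gt0 // ler_expR.
have fp (s : R) : 0 <= s -> 0 < f_exp n rho s.
  by move=> _; rewrite fE addr_gt0 // divr_gt0 // expR_gt0.
have fd (s : R) : 0 < s -> is_derive s 1 (f_exp n rho) (expR s / Z0).
  move=> _; have D := is_derive_addf (is_derive_mulf (is_derive_expR s)
    (is_derive_cst (Z0^-1) s 1)) (is_derive_cst K s 1).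
  by apply: (is_derive_eq D); rewrite mulr0 add0r addr0 mulrC.
have fdc (s : R) : 0 < s -> {for s, continuous (fun s : R => expR s / Z0)}.
  by move=> _; apply: (cont_mulf _ (cont_cst _ _)); exact: continuous_expR.
exact: (extremal n3 rho_gt0 ltr01 (lexx 0) K_gt0 c0 L0 KE ag kg Wd fU fsh fcv
  hd gr fc fh fp fd fdc).
Qed.

Let LE : 2 * 1 * (N - 2 * 0) = 2 * (n%:R - 2) :> R.
Proof. by rewrite mulr1 mulr0 subr0. Qed.

Lemma f_exp_lambda_star : lambda_star n rho (f_exp n rho) = 2 * (n%:R - 2).
Proof. by have [-> _] := exp_data; exact: LE. Qed.

Lemma f_exp_extremal (u : R -> 'rV[R]_n -> R) x :
  (forall l, 0 < l < 2 * (n%:R - 2) -> minimal_sol rho l (f_exp n rho) (u l)) ->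
  hball rho x -> x != 0 -> (fun l => u l x) @ (2 * (n%:R - 2))^'- -->
    - 2 * ln (sinhR (hdist0 x) / sinhR rho).
Proof.
move=> um xb x0; have [_] := exp_data; rewrite LE => /(_ u x um xb x0).
have [x1 _] := xb; have h0 := sinhR_gt0 (hdist0_gt0 x1 x0).
have r0 := sinhR_gt0 rho_gt0.
rewrite /W -sinhR_hdist0_sqr // /Z0 !lnXn // ln_div ?posrE //.
by rewrite (_ : - (_ *+ 2) - _ = - 2 * (ln (sinhR (hdist0 x)) - ln (sinhR rho))) //;
  ring.
Qed.

End Exponential.

(** * The power nonlinearity *)

Section Power.
Context {R : realType} {n : nat}.
Variables (rho m : R).
Hypotheses (n3 : (3 <= n)%N) (rho_gt0 : 0 < rho) (m_gt1 : 1 < m).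
Hypothesis dim_n : Ndim m <= n%:R.
Let N : R := n%:R - 2.
Let Z0 : R := sinhR rho ^+ 2.
Let al : R := (m - 1)^-1.
Let K : R := ((m - 1) * n%:R - (m + 1)) / ((m - 1) * n%:R - 2 * m).
Let W (z : R) : R := z `^ (- al).
Let f := f_pow n rho m.
Let a : R := W Z0.

Let m1_gt0 : 0 < m - 1.
Proof. by rewrite subr_gt0. Qed.

Let al_gt0 : 0 < al.
Proof. by rewrite invr_gt0. Qed.

Let mE : m = 1 + al^-1.
Proof. by rewrite invrK addrC subrK. Qed.

Let Z0_gt0 : 0 < Z0.
Proof. by rewrite exprn_gt0 // sinhR_gt0. Qed.

Let sqr_powR (s : R) : 0 < s -> s `^ (- (2 / (m - 1))) = W (s ^+ 2).
Proof.
by move=> s0; rewrite /W -powR_mulrn ?ltW // -powRrM -mulrN.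
Qed.

Let fE (s : R) : f s = (s + a) * ((s + a) `^ (m - 1) + K).
Proof. by rewrite /f /f_pow sqr_powR // sinhR_gt0. Qed.

(** Since m / (m - 1) = 1 + al, the number [r] is the square root occurring in [Ndim], and the
    dimension condition becomes polynomial in it. *)
Let N_bound : exists r : R, [/\ 1 <= r, r ^+ 2 = 1 + al & 4 * r ^+ 2 + 4 * r <= N].
Proof.
have mm : m / (m - 1) = 1 + al by rewrite /al; field; rewrite gt_eqF.
exists (Num.sqrt (1 + al)).
have a1 : 0 <= 1 + al by rewrite addr_ge0 // ltW.
rewrite sqr_sqrtr //; split => //.
  by rewrite -[leLHS]sqrtr1 ler_wsqrtr // lerDl ltW.
by move: dim_n; rewrite /Ndim /N -mulrA mm; lra.
Qed.

Let L : R := 2 * al * (N - 2 * al).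

Let N_facts : [/\ al + 1 <= N / 4, 0 < N - 2 * al, L * m <= N ^+ 2 / 4 &
  0 < (N / 2 - 2 * al) * (N / 2 + 1 - 2 * al)].
Proof.
have [r [r1 rE rN]] := N_bound; have a0 := al_gt0.
have alE : al = r ^+ 2 - 1 by rewrite rE; ring.
split; first by lra.
- by lra.
- have -> : L * m = 2 * (al + 1) * (N - 2 * al).
    by rewrite /L mE; field; rewrite gt_eqF.
  (* Completing the square: with al = r^2 - 1 the goal 2 * r^2 * (N - 2 * al) <= N^2 / 4 is this
     inequality expanded. This is where [Ndim] comes from. *)
  have : (4 * r) ^+ 2 <= (N - 4 * r ^+ 2) ^+ 2.
    by rewrite ler_pXn2r ?nnegrE //; lra.
  rewrite alE; nra.
- by rewrite mulr_gt0 //; lra.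
Qed.

Let K_eq : K = (N + 1 - 2 * al) / (N - 2 * al).
Proof.
have [_ Na _ _] := N_facts.
rewrite /K (_ : (m - 1) * n%:R - (m + 1) = (m - 1) * (N + 1 - 2 * al)); last first.
  by rewrite /N /al; field; rewrite gt_eqF.
rewrite (_ : (m - 1) * n%:R - 2 * m = (m - 1) * (N - 2 * al)); last first.
  by rewrite /N /al; field; rewrite gt_eqF.
by rewrite -mulf_div divff ?mul1r // gt_eqF.
Qed.

Let K_gt0 : 0 < K.
Proof. by have [_ Na _ _] := N_facts; rewrite K_eq divr_gt0 //; lra. Qed.

Let a_gt0 : 0 < a.
Proof. exact: powR_gt0. Qed.

Let powW (z : R) : 0 <= z -> W z `^ (m - 1) = z^-1.
Proof.
move=> z0; rewrite /W -powRrM mulNr (_ : al * (m - 1) = 1) ?powR_inv1 //.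
by rewrite mulVf // gt_eqF.
Qed.

Let WE (z : R) : 0 < z -> z `^ (- al - 1) = W z / z.
Proof. exact: powR_pred. Qed.

Let fU (z : R) : 0 < z <= Z0 -> f (W z - W Z0) = z `^ (- al - 1) * (1 + K * z).
Proof.
move=> /andP[z0 _]; rewrite fE subrK powW ?ltW // WE //.
by field; rewrite gt_eqF.
Qed.

(** [th] is the ratio of [W Z0] to [W (Z0 + dl)]. As it is at least 1 and W (z + dl) >= W (Z0 + dl),
    the base of the power is at most th * W (z + dl); raising to m - 1 turns [th] into 1 + dl /
    Z0. *)
Let f_shift (dl z : R) : 0 < dl -> - dl < z <= Z0 ->
  f (W (z + dl) - W (Z0 + dl)) <=
  (1 + dl / Z0) `^ (al + 1) * ((z + dl) `^ (- al - 1) * (1 + K * (z + dl))).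
Proof.
move=> dl0 /andP[dz zZ]; have zd : 0 < z + dl by lra.
have Zd : 0 < Z0 + dl by rewrite addr_gt0.
have h0 : 0 < 1 + dl / Z0 by rewrite addr_gt0 // divr_gt0.
have h1 : 1 <= 1 + dl / Z0 by rewrite lerDl divr_ge0 // ltW.
set th := (1 + dl / Z0) `^ al.
have th1 : 1 <= th by apply: powR_ge1 => //; exact: ltW.
have aE : a = W (Z0 + dl) * th.
  rewrite /a /th /W (_ : Z0 + dl = Z0 * (1 + dl / Z0)); last first.
    by field; rewrite gt_eqF.
  rewrite powRM ?(ltW Z0_gt0) ?(ltW h0) // -mulrA -powRD ?addNr ?powRr0 ?mulr1 //.
  by rewrite eqxx /= gt_eqF.
have wb : W (Z0 + dl) <= W (z + dl).
  by apply: powR_le0_anti => //; [rewrite oppr_le0 ltW|rewrite lerD2r].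
have w0 : 0 < W (Z0 + dl) by exact: powR_gt0.
set y := W (z + dl) - W (Z0 + dl) + a.
have y0 : 0 < y by rewrite /y ltr_wpDl // subr_ge0.
have yle : y <= W (z + dl) * th by rewrite /y aE; nra.
rewrite fE -/y.
have -> : (1 + dl / Z0) `^ (al + 1) = th * (1 + dl / Z0).
  by rewrite powRD ?powRr1 ?(ltW h0) //; apply/implyP => _; rewrite gt_eqF.
apply: (@le_trans _ _ (W (z + dl) * th * ((1 + dl / Z0) / (z + dl) + (1 + dl / Z0) * K))).
  apply: ler_pM => //; first exact: ltW.
    by rewrite addr_ge0 ?powR_ge0 // ltW.
  apply: lerD; last by rewrite ler_peMl // ltW.
  apply: (@le_trans _ _ ((W (z + dl) * th) `^ (m - 1))).
    apply: ge0_ler_powR; rewrite ?nnegrE ?(ltW y0) ?(ltW m1_gt0) //.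
    exact: le_trans (ltW y0) yle.
  rewrite powRM ?powR_ge0 // powW ?(ltW zd) // /th -powRrM.
  by rewrite (_ : al * (m - 1) = 1) ?powRr1 ?(ltW h0) ?mulVf ?gt_eqF // mulrC.
rewrite WE // le_eqVlt; apply/orP; left; apply/eqP; field.
by rewrite !gt_eqF.
Qed.

Let f_convex (z s : R) : 0 < z <= Z0 -> 0 <= s ->
  f (W z - W Z0) - f s <= (m / z + K) * (W z - W Z0 - s).
Proof.
move=> /andP[z0 _] s0; rewrite !fE subrK.
rewrite (_ : W z - W Z0 - s = W z - (s + a)); last by rewrite /a; ring.
have y0 : 0 < s + a by rewrite ltr_wpDl.
move: (s + a) y0 => y y0.
have v0 : 0 < W z by exact: powR_gt0.
have m0 : 0 < m by apply: lt_trans m_gt1.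
have mm (x : R) : 0 < x -> x * x `^ (m - 1) = x `^ m.
  by move=> x0; rewrite mulr_powRB1 ?ltW.
(* Young's inequality for the exponents [m] and [m / (m - 1)]. *)
have := @conjugate_powR R y (W z `^ (m - 1)) m (m / (m - 1)) (ltW y0) (powR_ge0 _ _) m0.
rewrite divr_gt0 // => /(_ isT) Y.
have {}Y : y * W z `^ (m - 1) <= y `^ m / m + W z `^ m / (m / (m - 1)).
  have -> : W z `^ m = (W z `^ (m - 1)) `^ (m / (m - 1)).
    by rewrite -powRrM mulrCA divff ?mulr1 // gt_eqF.
  by apply: Y; field; rewrite !gt_eqF.
rewrite [y * (_ + _)]mulrDr mm //; rewrite -(mm _ v0) in Y.
move: Y; rewrite powW ?(ltW z0) // => Y.
have {}Y : m * (y * z^-1) <= y `^ m + (m - 1) * (W z * z^-1).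
  rewrite -(ler_pM2l m0) in Y; apply: le_trans Y _.
  rewrite le_eqVlt; apply/orP; left; apply/eqP; field.
  by rewrite !gt_eqF.
have -> : (m / z + K) * (W z - y) = m * (W z * z^-1) - m * (y * z^-1) + K * (W z - y).
  by ring.
by lra.
Qed.

Let f' (s : R) : R := (s + a) * ((m - 1) * (s + a) `^ (m - 1 - 1))
  + ((s + a) `^ (m - 1) + K).

Let sa_d (s : R) : is_derive s 1 (fun s : R => s + a) 1.
Proof.
apply: (is_derive_eq (is_derive_addf (is_derive_id s 1) (is_derive_cst a s 1))).
by rewrite addr0.
Qed.

Let sap_d (s r : R) : 0 <= s ->
  is_derive s 1 (fun s : R => (s + a) `^ r) (r * (s + a) `^ (r - 1)).
Proof.
move=> s0; have y0 : 0 < s + a by rewrite ltr_wpDl.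
apply: (is_derive_eq (@is_derive_compf R (fun y => y `^ r) (fun s => s + a) s _ _
  (is_derive1_powR r y0) (sa_d s))).
by rewrite mulr1.
Qed.

Let f_d (s : R) : 0 <= s -> is_derive s 1 f (f' s).
Proof.
move=> s0; have -> : f = fun s => (s + a) * ((s + a) `^ (m - 1) + K).
  by apply/funext => t; exact: fE.
apply: (is_derive_eq (is_derive_mulf (sa_d s)
  (is_derive_addf (sap_d (m - 1) s0) (is_derive_cst K s 1)))).
by rewrite addr0 mulr1.
Qed.

Let f'_cont (s : R) : 0 < s -> {for s, continuous f'}.
Proof.
move=> /ltW s0; have pc r := is_derive_cont (sap_d r s0).
apply: cont_addf; last exact: (cont_addf (pc _) (cont_cst _ _)).
exact: (cont_mulf (is_derive_cont (sa_d s)) (cont_mulf (cont_cst _ _) (pc _))).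
Qed.

Let f_homo (s t : R) : 0 <= s -> s <= t -> f s <= f t.
Proof.
move=> s0 st; have y0 : 0 < s + a by rewrite ltr_wpDl.
have yz : s + a <= t + a by rewrite lerD2r.
have z0 := lt_le_trans y0 yz.
rewrite !fE; apply: ler_pM => //; first exact: ltW.
  by rewrite addr_ge0 ?powR_ge0 // ltW.
by rewrite lerD2r; apply: ge0_ler_powR; rewrite ?nnegrE ?(ltW y0) ?(ltW z0) // ltW.
Qed.

Let pow_data : lambda_star n rho f = L /\
  forall (u : R -> 'rV[R]_n -> R) x,
  (forall l, 0 < l < L -> minimal_sol rho l f (u l)) ->
  hball rho x -> x != 0 -> (fun l => u l x) @ L^'- --> W (sh2 (sqn x)) - W Z0.
Proof.
have [ag Na Lm c0] := N_facts; have K0 := K_gt0.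
have L0 : 0 < L by rewrite !mulr_gt0.
have KE : L * K = 2 * al * (N + 1 - 2 * al).
  by rewrite K_eq /L; field; rewrite gt_eqF.
have kg : al < N / 4 by have := al_gt0; lra.
have Wd (z : R) : 0 < z -> is_derive z 1 W (- al * z `^ (- al - 1)).
  by move=> z0; exact: is_derive1_powR.
(* The constant terms compare by the dimension condition. The coefficients of z agree exactly, which
   is how [c] is chosen. *)
have hd (z : R) : 0 < z <= Z0 -> L * (m / z + K) * z <=
    N ^+ 2 / 4 + z * (N * (N + 2) / 4 - (N / 2 - 2 * al) * (N / 2 + 1 - 2 * al)).
  move=> /andP[z0 _].
  have -> : L * (m / z + K) * z = L * m + z * (L * K) by field; rewrite gt_eqF.
  by apply: lerD => //; rewrite ler_pM2l // KE; lra.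
have gr (z : R) : 0 < z <= Z0 -> W z - W Z0 <= 1 * z `^ (- al).
  by move=> _; rewrite mul1r gerBl powR_ge0.
have fc (s : R) : 0 <= s -> {for s, continuous f}.
  by move=> s0; exact: is_derive_cont (f_d s0).
have fp (s : R) : 0 <= s -> 0 < f s.
  move=> s0; rewrite fE mulr_gt0 ?ltr_wpDl ?powR_ge0 //.
have fd (s : R) : 0 < s -> is_derive s 1 f (f' s) by move=> /ltW; exact: f_d.
exact: (extremal n3 rho_gt0 al_gt0 (ltW al_gt0) K0 c0 L0 KE ag kg Wd fU f_shift
  f_convex hd gr fc f_homo fp fd f'_cont).
Qed.

Let LE : L = 2 / (m - 1) * (n%:R - 2 * m / (m - 1)).
Proof. by rewrite /L /N /al; field; rewrite gt_eqF. Qed.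

Lemma f_pow_lambda_star : lambda_star n rho (f_pow n rho m) =
  2 / (m - 1) * (n%:R - 2 * m / (m - 1)).
Proof. by have [-> _] := pow_data; exact: LE. Qed.

Lemma f_pow_extremal (u : R -> 'rV[R]_n -> R) x :
  (forall l, 0 < l < 2 / (m - 1) * (n%:R - 2 * m / (m - 1)) ->
    minimal_sol rho l (f_pow n rho m) (u l)) ->
  hball rho x -> x != 0 ->
  (fun l => u l x) @ (2 / (m - 1) * (n%:R - 2 * m / (m - 1)))^'- -->
    sinhR (hdist0 x) `^ (- (2 / (m - 1))) - sinhR rho `^ (- (2 / (m - 1))).
Proof.
move=> um xb x0; have [_] := pow_data; rewrite LE => /(_ u x um xb x0).
have [x1 _] := xb.
by rewrite !sqr_powR ?sinhR_gt0 // ?hdist0_gt0 // sinhR_hdist0_sqr.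
Qed.

End Power.

Unset Implicit Arguments.
Theorem theorem1p5 (R : realType) (n : nat) (rho : R) :
  (3 <= n)%N -> 0 < rho ->
  ( (10 <= n)%N ->
    lambda_star n rho (f_exp n rho) = 2 * (n%:R - 2) /\
    forall u : R -> 'rV[R]_n -> R,
      (forall l, 0 < l < lambda_star n rho (f_exp n rho) ->
         minimal_sol rho l (f_exp n rho) (u l)) ->
      forall x, hball rho x -> x != 0 ->
        (fun l => u l x) @ (lambda_star n rho (f_exp n rho))^'-
          --> - 2 * ln (sinhR (hdist0 x) / sinhR rho) )
  /\
  ( forall m : R, 1 < m -> Ndim m <= n%:R ->
    lambda_star n rho (f_pow n rho m)
      = 2 / (m - 1) * (n%:R - 2 * m / (m - 1)) /\
    forall u : R -> 'rV[R]_n -> R,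
      (forall l, 0 < l < lambda_star n rho (f_pow n rho m) ->
         minimal_sol rho l (f_pow n rho m) (u l)) ->
      forall x, hball rho x -> x != 0 ->
        (fun l => u l x) @ (lambda_star n rho (f_pow n rho m))^'-
          --> powR (sinhR (hdist0 x)) (- (2 / (m - 1)))
              - powR (sinhR rho) (- (2 / (m - 1))) ).
Proof.
move=> n3 rho0; split=> [n10|m m1 nm].
  rewrite (f_exp_lambda_star n10 rho0); split=> // u um x xb x0.
  exact: (f_exp_extremal n10 rho0 um xb x0).
rewrite (f_pow_lambda_star n3 rho0 m1 nm); split=> // u um x xb x0.
exact: (f_pow_extremal n3 rho0 m1 nm um xb x0).
Qed.
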